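(* Let $T,L,\Omega,\Gamma>0$, $s\in\mathbb R$, and let $\chi:\mathbb R\to\mathbb R$ be an even, continuously differentiable function supported in $[-T,T]$. Let $\mathcal P$, $\mathcal M=\mathcal M(s)$, $\mathcal C_\Omega$ be as defined in the context, let $\rho_{AB}$ be the two-detector state with the perturbative expansion given in the context, and let $\widetilde\rho$ be its phase-calibrated version. Put $Z=-e^{-i\Omega s}\mathcal M$, $\mathcal H=\operatorname{Re}Z$, $\mathcal Q=\operatorname{Im}Z$. Then $$\mathcal H=\frac1{4\pi^2}\,\mathrm{PV}\!\int_{-2T}^{2T}\frac{\mathcal C_\Omega(\zeta)\,d\zeta}{L^2-(\zeta-s)^2},\qquad \mathcal Q=-\frac{\mathcal C_\Omega(s-L)+\mathcal C_\Omega(s+L)}{8\pi L},$$ and the mean reward $G$ of the quantum-input game described in the context, played with the resource $\widetilde\rho$ and local Bell readouts, satisfies $$G=-\Gamma\operatorname{Tr}[W_0\widetilde\rho]=\Gamma\lambda^2\left(\sqrt{\mathcal H^2+\mathcal Q^2}-\mathcal P\right)+O(\lambda^4)\qquad(\lambda\to0),$$ where $W_0=\tfrac12\mathbb I-\Phi^+$.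
   Context: Field coefficients (free massless scalar field in $3+1$ Minkowski vacuum, two static pointlike two-level detectors with gap $\Omega$ at distance $L$, switching functions $\chi(t)$ for Alice and $\chi(t-s)$ for Bob): $$\mathcal P=\lim_{\epsilon\downarrow0}\iint\chi(t)\chi(t')e^{-i\Omega(t-t')}\frac{-1}{4\pi^2(t-t'-i\epsilon)^2}\,dt\,dt',$$ $$\mathcal M(s)=-\lim_{\epsilon\downarrow0}\iint\chi(t)\chi(t'-s)e^{i\Omega(t+t')}\frac{1}{4\pi^2\,[L^2-(|t-t'|-i\epsilon)^2]}\,dt\,dt',$$ (the second kernel is the Feynman propagator $W_F(t-t',L)$), and $$\mathcal C_\Omega(\zeta)=\int_{\mathbb R}\chi(z+\zeta/2)\chi(z-\zeta/2)\cos(2\Omega z)\,dz .$$ $\mathrm{PV}$ is the Cauchy principal value (symmetric exclusion around each simple pole). Detector state. Each detector is a qubit with orthonormal basis $|g\rangle,|e\rangle$ (in this order). For small coupling $\lambda$, $\rho_{AB}=\rho_{AB}(\lambda)$ is a density matrix which in the ordered basis $(|gg\rangle,|ge\rangle,|eg\rangle,|ee\rangle)$ satisfies $$\rho_{AB}=\begin{pmatrix}1-2\lambda^2\mathcal P&0&0&\lambda^2\mathcal M^*\\0&\lambda^2\mathcal P&\lambda^2\mathcal L^*&0\\0&\lambda^2\mathcal L&\lambda^2\mathcal P&0\\\lambda^2\mathcal M&0&0&0\end{pmatrix}+O(\lambda^4),$$ where $\mathcal L\in\mathbb C$ is independent of $\lambda$ (its value does not enter the statement). The calibrated state is $\widetilde\rho=(U\otimes\mathbb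 I)\rho_{AB}(U^\dagger\otimes\mathbb I)$ with $U=\operatorname{diag}(1,e^{-i\theta})$ acting on Alice's detector and $\theta=\arg\mathcal M$ (any fixed $\theta$ if $\mathcal M=0$). Game. $\Phi^+$ denotes the projector onto $(|gg\rangle+|ee\rangle)/\sqrt2$ of a pair of qubits. The referee draws $q,r\in\{0,1,2,3\}$ independently and uniformly and sends question qubits $\tau_q$ to Alice and $\tau_r$ to Bob, where $\tau_q=\tfrac12(\mathbb I+\bm r_q\cdot\bm\sigma)$, $\bm\sigma$ are the Pauli matrices and $\bm r_0=\frac{(1,1,1)}{\sqrt3}$, $\bm r_1=\frac{(1,-1,-1)}{\sqrt3}$, $\bm r_2=\frac{(-1,1,-1)}{\sqrt3}$, $\bm r_3=\frac{(-1,-1,1)}{\sqrt3}$. Each player measures $\{\Phi^+,\mathbb I-\Phi^+\}$ on their question qubit and their own detector, answering $1$ on outcome $\Phi^+$ and $0$ otherwise. Thus, with tensor factors ordered (Alice's question $Q_A$, detector $A$, detector $B$, Bob's question $Q_B$), $p(1,1|q,r)=\operatorname{Tr}[(\Phi^+_{Q_AA}\otimes\Phi^+_{BQ_B})(\tau_q\otimes\widetilde\rho\otimes\tau_r)]$. If both answer $1$, the reward is the $(q,r)$ entry (rows $q$, columns $r$, indices $0,\dots,3$) of $$\Gamma\begin{pmatrix}8&8&-40&8\\8&8&8&-40\\-40&8&8&8\\8&-40&8&8\end{pmatrix};$$ every other answer pair gives reward $0$. $G$ is the expected reward. *)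

(* Defs.v *)
From HB Require Import structures.
From mathcomp Require Import all_boot all_order all_algebra.
From mathcomp Require Import all_classical all_reals all_analysis.
From mathcomp Require Import complex mxtens.

Set Implicit Arguments.
Unset Strict Implicit.
Unset Printing Implicit Defensive.

Import Order.TTheory GRing.Theory Num.Theory.
Import numFieldNormedType.Exports.

Local Open Scope classical_set_scope.
Local Open Scope ring_scope.
Local Open Scope complex_scope.
Local Open Scope sesquilinear_scope.

Definition expi (R : realType) (x : R) : R[i] := cos x +i* sin x.

(* Lebesgue integral over R^2 of a complex function, by components. *)
Definition cintegral2 (R : realType) (f : R * R -> R[i]) : R[i] :=
  let mu := (lebesgue_measure \x lebesgue_measure)%E in
  (\int[mu]_(x in [set: R * R]) complex.Re (f x)) +i*
  (\int[mu]_(x in [set: R * R]) complex.Im (f x)).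

Definition wightman_coincident (R : realType) (eps u : R) : R[i] :=
  - 1 / ((4 * pi ^+ 2)%:C * (u -i* eps) ^+ 2).

Definition feynman (R : realType) (L eps u : R) : R[i] :=
  1 / ((4 * pi ^+ 2)%:C * ((L ^+ 2)%:C - (`|u| -i* eps) ^+ 2)).

(* The regular module R[i]^o carries the topology of the complex norm, in which
   the limits below are taken. *)
Definition P_reg (R : realType) (Omega : R) (chi : R -> R) (eps : R) : R[i]^o :=
  cintegral2 (fun x => (chi x.1 * chi x.2)%:C * expi (- (Omega * (x.1 - x.2)))
                       * wightman_coincident eps (x.1 - x.2)).

Definition M_reg (R : realType) (L Omega s : R) (chi : R -> R) (eps : R)
    : R[i]^o :=
  - cintegral2 (fun x => (chi x.1 * chi (x.2 - s))%:C * expi (Omega * (x.1 + x.2))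
                         * feynman L eps (x.1 - x.2)).

(* The limit is real, so nothing is lost by taking the real part. *)
Definition P_exc (R : realType) (Omega : R) (chi : R -> R) : R :=
  complex.Re (lim (P_reg Omega chi eps @[eps --> 0^'+])).

Definition M_amp (R : realType) (L Omega s : R) (chi : R -> R) : R[i] :=
  lim (M_reg L Omega s chi eps @[eps --> 0^'+]).

Definition C_overlap (R : realType) (Omega : R) (chi : R -> R) (zeta : R) : R :=
  \int[lebesgue_measure]_(z in [set: R])
    (chi (z + zeta / 2) * chi (z - zeta / 2) * cos (2 * Omega * z)).

(* Principal value over [a, b]: delta-balls around the listed poles are removed
   and delta is sent to 0 from the right. *)
Definition pv_reg (R : realType) (a b : R) (poles : seq R) (f : R -> R)
    (delta : R) : R :=
  \int[lebesgue_measure]_(x in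
    `[a, b] `&` [set x | forall p, p \in poles -> delta <= `|x - p|]) f x.

Definition PV (R : realType) (a b : R) (poles : seq R) (f : R -> R) : R :=
  lim (pv_reg a b poles f delta @[delta --> 0^'+]).

Definition mx_of_rows (K : nmodType) (m n : nat) (rows : seq (seq K))
    : 'M[K]_(m, n) :=
  \matrix_(i, j) (nth [::] rows i)`_j.

Definition density_matrix (R : realType) (n : nat) (rho : 'M[R[i]]_n) : Prop :=
  [/\ rho ^t* = rho,
      forall v : 'cV[R[i]]_n, 0 <= (v ^t* *m rho *m v) 0 0
    & \tr rho = 1].

Definition rho_pert (R : realType) (P : R) (M Lc : R[i]) (lam : R)
    : 'M[R[i]]_4 :=
  let l2 := (lam ^+ 2)%:C in
  mx_of_rows 4 4
    [:: [:: 1 - 2 * l2 * P%:C; 0;         0;         l2 * M^*];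
        [:: 0;                 l2 * P%:C; l2 * Lc^*; 0];
        [:: 0;                 l2 * Lc;   l2 * P%:C; 0];
        [:: l2 * M;            0;         0;         0]].

(* The Kronecker product *t is row-major, so 'I_(2 * 2) is ordered gg, ge, eg, ee. *)
Definition calibrated (R : realType) (theta : R) (rho : 'M[R[i]]_(2 * 2))
    : 'M[R[i]]_(2 * 2) :=
  let U := mx_of_rows 2 2 [:: [:: 1; 0]; [:: 0; expi (- theta)]] in
  (U *t 1%:M) *m rho *m (U ^t* *t 1%:M).

Definition ket_g (R : realType) : 'cV[R[i]]_2 := delta_mx 0 0.
Definition ket_e (R : realType) : 'cV[R[i]]_2 := delta_mx 1 0.

Definition bell_ket (R : realType) : 'cV[R[i]]_(2 * 2) :=
  ((Num.sqrt 2)^-1)%:C *: (ket_g R *t ket_g R + ket_e R *t ket_e R).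

Definition Phi_plus (R : realType) : 'M[R[i]]_(2 * 2) :=
  bell_ket R *m (bell_ket R) ^t*.

Definition W0 (R : realType) : 'M[R[i]]_(2 * 2) := (2^-1)%:M - Phi_plus R.

Definition pauli (R : realType) (k : 'I_3) : 'M[R[i]]_2 :=
  nth 0 [:: mx_of_rows 2 2 [:: [:: 0; 1]; [:: 1; 0]];
            mx_of_rows 2 2 [:: [:: 0; - 'i]; [:: 'i; 0]];
            mx_of_rows 2 2 [:: [:: 1; 0]; [:: 0; - 1]]] k.

Definition bloch (R : realType) : 'M[R]_(4, 3) :=
  (Num.sqrt 3)^-1 *: mx_of_rows 4 3
    [:: [::   1;   1;   1];
        [::   1; - 1; - 1];
        [:: - 1;   1; - 1];
        [:: - 1; - 1;   1]].

Definition question (R : realType) (q : 'I_4) : 'M[R[i]]_2 :=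
  2^-1 *: (1%:M + \sum_(k < 3) (bloch R q k)%:C *: pauli R k).

Definition readout (R : realType) (a : bool) : 'M[R[i]]_(2 * 2) :=
  if a then Phi_plus R else 1%:M - Phi_plus R.

(* Tensor factors are ordered (Q_A, A, B, Q_B); *t is strictly associative on
   row-major indices, and both matrix sizes below reduce to 16. *)
Definition answer_prob (R : realType) (rho : 'M[R[i]]_(2 * 2)) (q r : 'I_4)
    (a b : bool) : R[i] :=
  \tr ((readout R a *t readout R b
         : 'M[R[i]]_(2 * 2 * (2 * 2))) *m
       (question R q *t rho *t question R r : 'M[R[i]]_(2 * (2 * 2) * 2))).

Definition reward_matrix (R : realType) (Gamma : R) : 'M[R]_4 :=
  Gamma *: mx_of_rows 4 4
    [:: [::    8;    8; - 40;    8];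
        [::    8;    8;    8; - 40];
        [:: - 40;    8;    8;    8];
        [::    8; - 40;    8;    8]].

Definition reward (R : realType) (Gamma : R) (q r : 'I_4) (a b : bool) : R :=
  if a && b then reward_matrix Gamma q r else 0.

Definition mean_reward (R : realType) (Gamma : R) (rho : 'M[R[i]]_(2 * 2))
    : R[i] :=
  \sum_(q < 4) \sum_(r < 4) (4^-1 * 4^-1) *
    \sum_(a : bool) \sum_(b : bool)
      answer_prob rho q r a b * (reward Gamma q r a b)%:C.

(* Main.v *)
Require Import Defs.
From HB Require Import structures.
From mathcomp Require Import all_boot all_order all_algebra.
From mathcomp Require Import all_classical all_reals all_analysis.
From mathcomp Require Import complex mxtens measurable_realfun ring lra.

Set Implicit Arguments.
Unset Strict Implicit.
Unset Printing Implicit Defensive.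

Import Order.TTheory GRing.Theory Num.Theory.
Import numFieldNormedType.Exports.

Local Open Scope classical_set_scope.
Local Open Scope ring_scope.
Local Open Scope complex_scope.

(* Put u = t - t' - s.  Evenness of chi removes the sine part of the overlap, so
   that -e^{-i Omega s} M is the limit of the integrals of
   C_Omega(zeta) W_F(zeta - s, L), W_F being the regularized Feynman propagator.  By
   partial fractions 1 / (L^2 - (|u| - i eps)^2) equals (2 L)^{-1} times the sum over
   a = L - u and a = L + u of a / (a^2 + eps^2) - i eps / (a^2 + eps^2), plus an
   imaginary part that vanishes as eps -> 0.  C_Omega is Lipschitz, so its value at a
   pole can be subtracted on a symmetric interval, after which dominated convergence
   applies: the real kernels are odd and have the same limit as the truncated 1 / a
   of the principal value, while the imaginary ones have mass pi.

   P is treated in the same way with double poles: the autocorrelation D of chi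
   satisfies |D(u) - D(0)| <= K u^2.

   For the game, the Bell readout transposes the question onto the detector, and
   sum_{q,r} w_{qr} tau_q (x) tau_r = -64 W_0, because the question vectors form a
   regular tetrahedron and the exceptional pairs (q, r) differ by a rotation by pi
   about the y axis. *)

(** * Invariance and dominated convergence on the line *)

(** The field coefficients and the principal value are defined with [lim], a total operator, so
    every value has to come with a proof of convergence, even that of [P_exc], for which no closed
    form is claimed. One lemma, [kernel_cvg], serves all singular kernels: it takes a weight [w]
    that measures the order of the pole ([|x|] or [x ^+ 2]) and the limit [c] of the mass of the
    kernel on a symmetric interval. The delicate point of the principal value is that both balls are
    cut out of the whole integrand, whereas partial fractions produce two terms, each naturally cut
    at its own pole only; a correction whose integral is of order [e] reconciles the two. In the
    game, W_0 has zero diagonal entries at gg and ee, so the order-zero part of the state earns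
    nothing; the mean reward is linear in the state, so an entrywise error of order lambda^4 stays
    of that order. *)

Section LebesgueOnTheLine.
Context {R : realType}.
Notation mu := (@lebesgue_measure R).
Implicit Types (f g h : R -> R) (A B c e : R).

Lemma measurable_inv : measurable_fun [set: R] (fun x : R => x^-1).
Proof.
have -> : [set: R] = [set 0] `|` [set~ (0 : R)] by rewrite setUv.
apply/measurable_funU => //; first exact: measurableC.
split; first exact: measurable_fun_set1.
apply: open_continuous_measurable_fun.
  exact/closed_openC/closed_eq.
by move=> x; rewrite inE/= => /eqP x0; exact: inv_continuous.
Qed.

Lemma measurable_funV d (X : measurableType d) (f : X -> R) :
  measurable_fun setT f -> measurable_fun setT (fun x => (f x)^-1).
Proof. by move=> mf; exact: (measurableT_comp measurable_inv). Qed.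

Lemma measurable_cos : measurable_fun [set: R] (@cos R).
Proof. by apply: continuous_measurable_fun; exact: continuous_cos. Qed.

Lemma measurable_sin : measurable_fun [set: R] (@sin R).
Proof. by apply: continuous_measurable_fun; exact: continuous_sin. Qed.

Lemma measurable_le_indic d (X : measurableType d) (f g : X -> R) :
  measurable_fun setT f -> measurable_fun setT g ->
  measurable_fun setT (fun x => (f x <= g x)%R%:R : R).
Proof.
move=> mf mg; have mle := (measurable_fun_ler mf mg).
rewrite (_ : (fun x => _) = \1_[set x | (f x <= g x)%R]).
  apply: measurable_indic.
  rewrite -[X in measurable X]setTI.
  exact: (mle measurableT [set true]).
apply/funext => x; rewrite indicE; congr (_%:R); congr nat_of_bool.
by apply/idP/idP; rewrite inE.
Qed.

Section Invariance.
Variable phi : R -> R.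
Hypothesis mphi : measurable_fun setT phi.
Hypothesis muphi : forall U : set (measurableTypeR R), measurable U ->
  pushforward mu (phi : _ -> measurableTypeR R) U = mu U.

Lemma ge0_integral_invariant (f : R -> \bar R) :
  measurable_fun setT f -> (forall x, 0 <= f x)%E ->
  (\int[mu]_x f (phi x) = \int[mu]_x f x)%E.
Proof.
move=> mf f0.
have := @ge0_integral_pushforward _ _ (measurableTypeR R) (measurableTypeR R)
  _ phi mphi mu setT f measurableT mf (fun y _ => f0 y).
rewrite preimage_setT => <-.
by apply: eq_measure_integral => //= U mU _; exact: muphi.
Qed.

(** Positive and negative parts are transported separately, so the identity covers every measurable
    [f], integrable or not. *)
Lemma Rintegral_invariant f :
  measurable_fun setT f -> \int[mu]_x f (phi x) = \int[mu]_x f x.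
Proof.
move=> mf; rewrite /Rintegral; congr fine.
have mEf : measurable_fun setT (EFin \o f) by exact/measurable_EFinP.
rewrite [LHS]integralE [RHS]integralE; congr (_ - _)%E.
- rewrite -[RHS](ge0_integral_invariant (measurable_funepos mEf)
                                        (funepos_ge0 (EFin \o f))).
  by apply: eq_integral => x _; rewrite -[LHS]/((((EFin \o f) \o phi)^\+)%E x) funepos_comp.
- rewrite -[RHS](ge0_integral_invariant (measurable_funeneg mEf)
                                        (funeneg_ge0 (EFin \o f))).
  by apply: eq_integral => x _; rewrite -[LHS]/((((EFin \o f) \o phi)^\-)%E x) funeneg_comp.
Qed.

End Invariance.

(** Lebesgue measure is determined by its values on half-open intervals. Packing the translation as
    a measurable function lets its pushforward be recognized as a measure, to which this uniqueness
    applies. *)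
Lemma lebesgue_measure_shift c (U : set (measurableTypeR R)) : measurable U ->
  pushforward mu ((fun x => x + c) : _ -> measurableTypeR R) U = mu U.
Proof.
have mphi : measurable_fun setT
    ((fun x => x + c) : measurableTypeR R -> measurableTypeR R).
  by apply: measurable_funD; [exact: measurable_id|exact: measurable_cst].
pose mixin := isMeasurableFun.Build _ _ _ _ _ mphi.
pose phi : {mfun measurableTypeR R >-> measurableTypeR R}  :=
  HB.pack ((fun x => x + c) : measurableTypeR R -> measurableTypeR R) mixin.
move=> mU; rewrite -[_ U]/(pushforward mu phi U).
apply/esym/lebesgue_measure_unique => //= _ [[a b]] _ <-.
rewrite /pushforward/= lebesgue_measure_itv/=.
rewrite (_ : _ @^-1` _ = `]a - c, b - c]%classic); last first.
  by apply/seteqP; split=> x/=; rewrite !in_itv/= ltrBlDr lerBrDr.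
by rewrite lebesgue_measure_itv/= !lte_fin ltrD2r -!EFinB opprB addrA subrK.
Qed.

Lemma Rintegral_shift f c :
  measurable_fun setT f -> \int[mu]_x f (x + c) = \int[mu]_x f x.
Proof.
move=> mf; apply: (Rintegral_invariant (phi := fun x => x + c)) => //.
  by apply: measurable_funD; [exact: measurable_id|exact: measurable_cst].
exact: lebesgue_measure_shift.
Qed.

Lemma Rintegral_opp f :
  measurable_fun setT f -> \int[mu]_x f (- x) = \int[mu]_x f x.
Proof.
move=> mf; apply: (Rintegral_invariant (phi := -%R)) => //.
exact: lebesgue_measureN.
Qed.

End LebesgueOnTheLine.

(** * Bounded functions of compact support, and limits under the integral sign *)

Section CompactSupport.
Context {R : realType}.
Notation mu := (@lebesgue_measure R).
Implicit Types (f g h : R -> R) (A B c e : R).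

Definition supported_in (A : R) (f : R -> R) := forall x, A < `|x| -> f x = 0.

(** Real-valued, so that it can multiply integrands over the whole line: it serves both as a cutoff
    and, scaled, as the dominating function. *)
Definition box (A x : R) : R := (`|x| <= A)%R%:R.

Lemma boxE A : box A = \1_(`[- A, A]%classic : set R).
Proof. by apply/funext => x; rewrite indicE mem_setE in_itv/= -ler_norml. Qed.

Lemma measurable_box A : measurable_fun setT (box A).
Proof. by rewrite boxE; exact: measurable_indic. Qed.

Lemma integrable_box A B : mu.-integrable setT (EFin \o (fun x => B * box A x)).
Proof.
rewrite (_ : EFin \o _ = (fun x => B%:E * (EFin \o box A) x)%E) //.
by apply: integrableZl => //; rewrite boxE; exact: integrable_indic_itv.
Qed.

Lemma supported_le_box A B f : supported_in A f -> (forall x, `|f x| <= B) ->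
  forall x, `|f x| <= B * box A x.
Proof.
move=> sf fB x; rewrite /box; have [_|xA] := leP `|x| A.
  by rewrite mulr1n mulr1.
by rewrite sf// normr0 mulr0n mulr0.
Qed.

Lemma integrable_le f g : measurable_fun setT f ->
  mu.-integrable setT (EFin \o g) -> (forall x, `|f x| <= g x) ->
  mu.-integrable setT (EFin \o f).
Proof.
move=> mf ig fg; apply: le_integrable ig => //; first exact/measurable_EFinP.
by move=> x _ /=; rewrite lee_fin (le_trans (fg _))// ler_norm.
Qed.

Lemma integrable_supported A B f : measurable_fun setT f ->
  supported_in A f -> (forall x, `|f x| <= B) ->
  mu.-integrable setT (EFin \o f).
Proof.
move=> mf sf fB; apply: integrable_le (integrable_box A B) _ => //.
exact: supported_le_box.
Qed.

Lemma Rintegral_box A : 0 <= A -> \int[mu]_x box A x = 2 * A.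
Proof.
move=> A0; rewrite /Rintegral boxE integral_indic// setIT.
rewrite /= lebesgue_measure_itv/= lte_fin; case: ltP => /= [_|]; first by ring.
by lra.
Qed.

Lemma normr_Rintegral_le A B f : 0 <= A -> measurable_fun setT f ->
  supported_in A f -> (forall x, `|f x| <= B) ->
  `|\int[mu]_x f x| <= 2 * A * B.
Proof.
move=> A0 mf sf fB.
apply: le_trans (le_normr_Rintegral _ (integrable_supported mf sf fB)) _ => //.
have -> : 2 * A * B = \int[mu]_x (B * box A x).
  rewrite RintegralZl//; first by rewrite Rintegral_box// mulrC.
  by have := integrable_box A 1; apply: eq_integrable => // x _ /=; rewrite mul1r.
apply: le_Rintegral => //.
- apply: (@integrable_supported A B); first exact: measurableT_comp.
    by move=> x Ax; rewrite sf// normr0.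
  by move=> x; rewrite normr_id.
- exact: integrable_box.
- by move=> x _; exact: supported_le_box.
Qed.

Lemma Rintegral_odd f : mu.-integrable setT (EFin \o f) ->
  (forall x, f (- x) = - f x) -> \int[mu]_x f x = 0.
Proof.
move=> intf fN; have mf : measurable_fun setT f.
  by apply/measurable_EFinP; exact: measurable_int intf.
have : \int[mu]_x f x = - \int[mu]_x f x.
  rewrite -[LHS]Rintegral_opp// -mulN1r -RintegralZl//.
  by apply: eq_Rintegral => x _; rewrite fN mulN1r.
by move=> ?; lra.
Qed.

(** A one-sided limit can be tested along sequences, which carries dominated convergence over to a
    continuous parameter. *)
Lemma Rintegral_cvg_at_right0 (F : R -> R -> R) g h :
  (forall e, 0 < e -> measurable_fun setT (F e)) ->
  mu.-integrable setT (EFin \o h) ->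
  (forall e x, 0 < e -> `|F e x| <= h x) ->
  (forall x, F e x @[e --> 0^'+] --> g x) ->
  \int[mu]_x F e x @[e --> 0^'+] --> \int[mu]_x g x.
Proof.
move=> mF ih Fh Fg; apply/cvg_at_rightP => u [u0 ucvg].
have Fug x : F (u n) x @[n --> \oo] --> g x.
  by have /cvg_at_rightP := Fg x; apply.
have mg : measurable_fun setT g.
  by apply: (measurable_fun_cvg (h := fun n => F (u n))) => // n; exact: mF.
have [||||| ig _ cvgI] := @dominated_convergence _ _ _ mu setT measurableT
  (fun n => EFin \o F (u n)) (EFin \o g) (EFin \o h).
- by move=> n; apply/measurable_EFinP; apply: mF; exact: u0.
- exact/measurable_EFinP.
- by apply: aeW => x _ /=; apply/fine_cvgP; split; [exact: nearW|exact: Fug].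
- exact: ih.
- by apply: aeW => x n _ /=; rewrite lee_fin; exact/Fh/u0.
rewrite /Rintegral; apply: fine_cvg; rewrite fineK//.
exact: integrable_fin_num.
Qed.

End CompactSupport.

(** * Singular kernels *)

Section SingularKernels.
Context {R : realType}.
Notation mu := (@lebesgue_measure R).
Implicit Types (f g h : R -> R) (A B c e : R).

(** Since [g] lives on [[-A, A]], it is [(g - g 0) * box A + g 0 * box A]. In the first term the
    factor [K * w] tames the kernel uniformly in [e], so dominated convergence applies; the second
    is [g 0] times the truncated mass of the kernel, whose limit [c] is supplied. The bound of [k e]
    may blow up with [e]: it only makes the integrals finite so that they can be split. *)
Lemma kernel_cvg (k : R -> R -> R) (k0 w g : R -> R) A B K N c :
  measurable_fun setT g -> supported_in A g -> (forall x, `|g x| <= B) ->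
  0 <= K -> (forall x, `|x| <= A -> `|g x - g 0| <= K * w x) ->
  (forall e, 0 < e -> measurable_fun setT (k e)) ->
  (forall e, 0 < e -> exists M, forall x, `|k e x| <= M) ->
  (forall e x, 0 < e -> w x * `|k e x| <= N) ->
  (forall x, x != 0 -> k e x @[e --> 0^'+] --> k0 x) ->
  \int[mu]_x (box A x * k e x) @[e --> 0^'+] --> c ->
  \int[mu]_x (g x * k e x) @[e --> 0^'+] -->
    \int[mu]_x ((g x - g 0) * box A x * k0 x) + g 0 * c.
Proof.
move=> mg sg gB K0 gK mk kM kN kk0 kc.
pose G x := (g x - g 0) * box A x.
have mG : measurable_fun setT G.
  apply: measurable_funM; last exact: measurable_box.
  by apply: measurable_funB => //; exact: measurable_cst.
have B0 : 0 <= B by exact: le_trans (gB 0).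
have boxsup x : A < `|x| -> box A x = 0 by rewrite /box ltNge => /negbTE ->.
have box01 x : `|box A x| <= 1.
  by rewrite /box; case: (`|x| <= A); rewrite ?mulr1n ?mulr0n ?normr1 ?normr0 ?lexx ?ler01.
have GK x : `|G x| <= K * w x * box A x.
  rewrite /G /box; have [xA|] := leP `|x| A; last by rewrite !mulr0n !mulr0 normr0.
  by rewrite mulr1n !mulr1 gK.
have -> : \int[mu]_x ((g x - g 0) * box A x * k0 x) = \int[mu]_x (G x * k0 x) by [].
have Ge e : 0 < e -> \int[mu]_x (g x * k e x) =
    \int[mu]_x (G x * k e x) + g 0 * \int[mu]_x (box A x * k e x).
  move=> e0; have [M kMe] := kM _ e0.
  have M0 : 0 <= M by exact: le_trans (kMe 0).
  have ib : mu.-integrable setT (EFin \o (fun x => box A x * k e x)).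
    apply: (@integrable_supported _ A M).
    - by apply: measurable_funM; [exact: measurable_box|exact: mk].
    - by move=> x /boxsup ->; rewrite mul0r.
    - by move=> x; rewrite normrM -[leRHS]mul1r ler_pM.
  rewrite -RintegralZl// -RintegralD//.
  - apply: eq_Rintegral => x _; rewrite /G /box.
    have [_|xA] := leP `|x| A; first by rewrite mulr1n; ring.
    by rewrite sg// mulr0n; ring.
  - apply: (@integrable_supported _ A (2 * B * M)).
    + by apply: measurable_funM => //; exact: mk.
    + by move=> x /boxsup xA; rewrite /G xA mulr0 mul0r.
    + move=> x; rewrite normrM ler_pM// /G normrM.
      rewrite -[leRHS]mulr1 ler_pM// (le_trans (ler_normB _ _))//.
      by have := gB x; have := gB 0; lra.
  - have := integrableZl measurableT (g 0) ib.
    by apply: eq_integrable => // x _ /=; rewrite EFinM.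
apply: (@cvg_trans _ ((fun e => \int[mu]_x (G x * k e x) +
    g 0 * \int[mu]_x (box A x * k e x)) @ 0^'+)).
  apply: near_eq_cvg; near=> e; rewrite Ge//.
apply: cvgD; last by apply: cvgM => //; exact: cvg_cst.
apply: (@Rintegral_cvg_at_right0 _ _ _ (fun x => K * N * box A x)).
- by move=> e e0; apply: measurable_funM => //; exact: mk.
- exact: integrable_box.
- move=> e x e0; rewrite normrM.
  apply: (@le_trans _ _ (K * w x * box A x * `|k e x|)).
    by rewrite ler_wpM2r.
  have -> : K * w x * box A x * `|k e x| = K * (w x * `|k e x|) * box A x by ring.
  rewrite ler_wpM2r//.
  by rewrite ler_wpM2l// kN.
(* At the pole [G] is zero, so the value that [k0] takes there is immaterial. *)
- move=> x; have [->|x0] := eqVneq x 0.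
    rewrite /G subrr mul0r mul0r; under eq_fun do rewrite mul0r.
    exact: cvg_cst.
  by apply: cvgM; [exact: cvg_cst|exact: kk0].
Unshelve. all: by end_near. Qed.

Lemma cvg_atan_div A : 0 < A -> atan (A / e) @[e --> (0 : R)^'+] --> pi / 2.
Proof.
move=> A0; apply: (@cvg_comp _ _ _ (fun e => A / e) atan _ +oo);
  last exact: cvgy_atan.
apply/cvgryPge => M.
have dM : 0 < A / (`|M| + 1) by apply: divr_gt0 => //; rewrite ltr_wpDl.
near=> e; have e0 : 0 < e by near: e; exact: nbhs_right_gt.
have eA : e < A / (`|M| + 1) by near: e; exact: nbhs_right_lt.
rewrite ler_pdivlMr// (@le_trans _ _ ((`|M| + 1) * e))//.
  by rewrite ler_wpM2r ?ltW// (le_lt_trans (ler_norm M))// ltrDl.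
by rewrite mulrC -ler_pdivlMr ?ltW// ltr_wpDl.
Unshelve. all: by end_near. Qed.

Lemma Rintegral_box_FTC (F f : R -> R) A : 0 < A ->
  (forall x : R, is_derive x (1 : R) F (f x)) -> continuous f ->
  \int[mu]_x (box A x * f x) = F A - F (- A).
Proof.
move=> A0 dF cf.
have -> : \int[mu]_x (box A x * f x) = \int[mu]_(x in `[- A, A]) f x.
  rewrite [RHS]Rintegral_mkcond; apply: eq_Rintegral => x _.
  rewrite boxE patchE indicE; case: ifP => _; first by rewrite mul1r.
  by rewrite mul0r.
have cF : continuous F.
  by move=> x; apply/differentiable_continuous/derivable1_diffP.
rewrite /Rintegral (@continuous_FTC2 _ f F (- A) A)//.
- lra.
- exact: continuous_subspaceT.
- split=> [x _||]; first by [].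
  + by apply: cvg_at_right_filter; exact: cF.
  + by apply: cvg_at_left_filter; exact: cF.
- by move=> x _; rewrite derive1E derive_val.
Qed.

Lemma cvg_at_right_of (f : R -> R) (l : R) :
  {for 0, continuous f} -> f 0 = l -> f e @[e --> 0^'+] --> l.
Proof. by move=> cf <-; apply: cvg_at_right_filter. Qed.

Lemma sqrD_gt0 (x e : R) : 0 < e -> 0 < x ^+ 2 + e ^+ 2.
Proof. by move=> e0; rewrite ltr_wpDl ?sqr_ge0// exprn_gt0. Qed.

(** The imaginary part of [1 / (x - i e)], left unnormalized with total mass [pi];
    [conj_poisson_kernel] is the real part. *)
Definition poisson_kernel (e x : R) := e / (x ^+ 2 + e ^+ 2).

Definition conj_poisson_kernel (e x : R) := x / (x ^+ 2 + e ^+ 2).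

Definition truncated_inv (e x : R) := (e <= `|x|)%R%:R / x.

(** This is [x] times the imaginary part of [1 / (x - i e)^2]; like the Poisson kernel it has total
    mass [pi] and concentrates at 0. *)
Definition square_poisson_kernel (e x : R) :=
  2 * e * x ^+ 2 / (x ^+ 2 + e ^+ 2) ^+ 2.

(** The real part of [1 / (x - i e)^2], a regularization of the Hadamard finite part of
    [1 / x^2]. *)
Definition finite_part_kernel (e x : R) :=
  (x ^+ 2 - e ^+ 2) / (x ^+ 2 + e ^+ 2) ^+ 2.

Lemma continuous_over_sqrD (f : R -> R) e : 0 < e -> continuous f ->
  continuous (fun x => f x / (x ^+ 2 + e ^+ 2)).
Proof.
move=> e0 cf x; apply: cvgM; first exact: cf.
apply: cvgV; first by rewrite gt_eqF// sqrD_gt0.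
apply: cvgD; last exact: cvg_cst.
exact: exprn_continuous.
Qed.

Lemma is_derive_atan_div e (x : R) : 0 < e ->
  is_derive x (1 : R) (fun y => atan (y / e)) (poisson_kernel e x).
Proof.
move=> e0; have en : e != 0 by rewrite gt_eqF.
have -> : poisson_kernel e x = (1 + (x / e) ^+ 2)^-1 * (e^-1 *: 1).
  rewrite /poisson_kernel scaler1; have := sqrD_gt0 x e0; rewrite lt0r => /andP[nz _].
  have nz' : 1 + (x / e) ^+ 2 != 0 by rewrite gt_eqF// ltr_pwDl// sqr_ge0.
  have nz2 : e ^+ 2 + x ^+ 2 != 0 by rewrite addrC.
  by field; rewrite ?en ?nz ?nz2.
apply: (@is_derive1_comp _ atan (fun y => y / e)).
have -> : (fun y : R => y / e) = (e^-1 \*: (id : R -> R)).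
  by apply/funext => y; rewrite mulrC.
exact: is_deriveZ.
Qed.

Lemma is_derive_div_sqrD (f : R -> R) df e (x : R) : 0 < e ->
  is_derive x (1 : R) f df ->
  is_derive x (1 : R) (fun y => f y / (y ^+ 2 + e ^+ 2))
    (df / (x ^+ 2 + e ^+ 2) - 2 * x * f x / (x ^+ 2 + e ^+ 2) ^+ 2).
Proof.
move=> e0 dfx.
have nz : x ^+ 2 + e ^+ 2 != 0 by rewrite gt_eqF// sqrD_gt0.
have dS : is_derive x (1 : R) (fun y : R => y ^+ 2 + e ^+ 2) (2 * x).
  have -> : (fun y : R => y ^+ 2 + e ^+ 2) = (id ^+ 2 : R -> R) + cst (e ^+ 2).
    by apply/funext => y.
  have -> : 2 * x = (2%:R * x ^+ 1) *: (1 : R) + 0.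
    by rewrite addr0 expr1 /GRing.scale/= mulr1.
  by apply: is_deriveD.
have H := is_deriveM dfx (@is_deriveV _ (fun y : R => y ^+ 2 + e ^+ 2) x _ _ nz dS).
apply: (is_derive_eq H).
rewrite /GRing.scale/=.
by field.
Qed.

Lemma cvg_sqrD (x : R) : x ^+ 2 + e ^+ 2 @[e --> (0 : R)^'+] --> x ^+ 2.
Proof.
apply: cvg_at_right_of; last by rewrite expr0n addr0.
by apply: cvgD; [exact: cvg_cst|exact: exprn_continuous].
Qed.

Lemma cvg_id_at_right0 : e @[e --> (0 : R)^'+] --> (0 : R).
Proof. by apply: cvg_at_right_of => //; exact: cvg_id. Qed.

Lemma cvg_over_sqrD (u : R -> R) (l x : R) n : x != 0 ->
  u e @[e --> 0^'+] --> l ->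
  u e / (x ^+ 2 + e ^+ 2) ^+ n @[e --> 0^'+] --> l / (x ^+ 2) ^+ n.
Proof.
move=> x0 ul; apply: cvgM => //; apply: cvgV; first by rewrite !expf_neq0.
apply: (@cvg_comp _ _ _ _ (fun y : R => y ^+ n)); first exact: cvg_sqrD.
exact: exprn_continuous.
Qed.

Lemma mul2_le_sqrD (x e : R) : 2 * (`|x| * e) <= x ^+ 2 + e ^+ 2.
Proof. by rewrite -(real_normK (num_real x)); have := sqr_ge0 (`|x| - e); nra. Qed.

Lemma poisson_kernel_ge0 e x : 0 < e -> 0 <= poisson_kernel e x.
Proof. by move=> e0; rewrite divr_ge0 ?ltW// sqrD_gt0. Qed.

Lemma poisson_kernel_le e x : 0 < e -> poisson_kernel e x <= e^-1.
Proof.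
move=> e0; rewrite ler_pdivrMr ?sqrD_gt0// ler_pdivlMl//.
by rewrite expr2 lerDr sqr_ge0.
Qed.

Lemma poisson_kernel_leV e x : 0 < e -> `|x| * poisson_kernel e x <= 1.
Proof.
move=> e0; rewrite mulrA ler_pdivrMr ?sqrD_gt0// mul1r.
apply: le_trans (mul2_le_sqrD x e); rewrite mulr_natl mulr2n lerDl.
by rewrite mulr_ge0// ltW.
Qed.

Lemma cvg_poisson_kernel x : x != 0 -> poisson_kernel e x @[e --> 0^'+] --> 0.
Proof.
move=> x0; rewrite -[X in _ --> X](mul0r ((x ^+ 2) ^+ 1)^-1).
by apply: (@cvg_over_sqrD id) => //; exact: cvg_id_at_right0.
Qed.

Lemma continuous_poisson_kernel e : 0 < e -> continuous (poisson_kernel e).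
Proof. by move=> e0; apply: continuous_over_sqrD => // x; exact: cvg_cst. Qed.

Lemma Rintegral_poisson_kernel e A : 0 < e -> 0 < A ->
  \int[mu]_x (box A x * poisson_kernel e x) = 2 * atan (A / e).
Proof.
move=> e0 A0.
rewrite (Rintegral_box_FTC A0 (fun x => is_derive_atan_div x e0)).
  by rewrite mulNr atanN; ring.
exact: continuous_poisson_kernel.
Qed.

Lemma cvg_2atan_div A : 0 < A -> 2 * atan (A / e) @[e --> (0 : R)^'+] --> pi.
Proof.
move=> A0; rewrite [X in _ --> X](_ : _ = 2 * (pi / 2)); last by field.
by apply: cvgM; [exact: cvg_cst|exact: cvg_atan_div].
Qed.

End SingularKernels.

(** * Limits of integrals against each singular kernel *)

Section KernelLimits.
Context {R : realType}.
Notation mu := (@lebesgue_measure R).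
Implicit Types (g : R -> R) (A B K e x : R).

Lemma square_poisson_kernel_le e x : 0 < e ->
  0 <= square_poisson_kernel e x <= 2 * poisson_kernel e x.
Proof.
move=> e0; have S0 := sqrD_gt0 x e0.
rewrite /square_poisson_kernel divr_ge0/= ?sqr_ge0//; last first.
  by rewrite mulr_ge0 ?sqr_ge0// mulr_ge0// ltW.
rewrite ler_pdivrMr ?exprn_gt0// /poisson_kernel.
have -> : 2 * (e / (x ^+ 2 + e ^+ 2)) * (x ^+ 2 + e ^+ 2) ^+ 2 =
  2 * e * (x ^+ 2 + e ^+ 2) by field; rewrite gt_eqF.
by rewrite ler_wpM2l ?lerDl ?sqr_ge0// mulr_ge0// ltW.
Qed.

Lemma finite_part_kernel_le e x : 0 < e ->
  `|finite_part_kernel e x| <= (x ^+ 2 + e ^+ 2)^-1.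
Proof.
move=> e0; have S0 := sqrD_gt0 x e0.
rewrite normrM normfV (ger0_norm (sqr_ge0 _)) ler_pdivrMr ?exprn_gt0//.
have -> : (x ^+ 2 + e ^+ 2)^-1 * (x ^+ 2 + e ^+ 2) ^+ 2 = x ^+ 2 + e ^+ 2.
  by field; rewrite gt_eqF.
by rewrite (le_trans (ler_normB _ _))// !ger0_norm ?sqr_ge0.
Qed.

Lemma conj_poisson_kernel_le e x : 0 < e -> `|conj_poisson_kernel e x| <= e^-1.
Proof.
move=> e0; have S0 := sqrD_gt0 x e0.
rewrite normrM normfV (gtr0_norm S0) ler_pdivrMr// ler_pdivlMl// mulrC.
apply: le_trans (mul2_le_sqrD x e); rewrite mulr_natl mulr2n lerDl.
by rewrite mulr_ge0// ltW.
Qed.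

Lemma conj_poisson_kernel_leV e x : 0 < e ->
  `|x| * `|conj_poisson_kernel e x| <= 1.
Proof.
move=> e0; have S0 := sqrD_gt0 x e0.
rewrite normrM normfV (gtr0_norm S0) mulrA ler_pdivrMr// mul1r -expr2.
by rewrite real_normK ?num_real// lerDl sqr_ge0.
Qed.

Lemma truncated_inv_le e x : 0 < e -> `|truncated_inv e x| <= e^-1.
Proof.
move=> e0; rewrite /truncated_inv; have [ex|_] := leP e `|x|.
  by rewrite mulr1n mul1r normfV lef_pV2// posrE// (lt_le_trans e0).
by rewrite mulr0n mul0r normr0 invr_ge0 ltW.
Qed.

Lemma truncated_inv_leV e x : `|x| * `|truncated_inv e x| <= 1.
Proof.
rewrite /truncated_inv; case: (e <= `|x|); last by rewrite mulr0n mul0r normr0 mulr0.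
rewrite mulr1n mul1r normfV; have [->|x0] := eqVneq x 0.
  by rewrite normr0 mul0r.
by rewrite divff// normr_eq0.
Qed.

Lemma measurable_truncated_inv e : measurable_fun setT (truncated_inv e).
Proof.
apply: measurable_funM; last exact: measurable_inv.
by apply: measurable_le_indic; [exact: measurable_cst|exact: normr_measurable].
Qed.

Lemma measurable_conj_poisson_kernel e : 0 < e ->
  measurable_fun setT (conj_poisson_kernel e).
Proof.
move=> e0; apply: continuous_measurable_fun; apply: continuous_over_sqrD => //.
by move=> x; exact: cvg_id.
Qed.

Lemma Rintegral_box_odd (k : R -> R) A M : measurable_fun setT k ->
  (forall x, `|k x| <= M) -> (forall x, k (- x) = - k x) ->
  \int[mu]_x (box A x * k x) = 0.
Proof.
move=> mk kM kN; apply: Rintegral_odd.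
  apply: (@integrable_supported _ A M).
  - by apply: measurable_funM => //; exact: measurable_box.
  - by move=> x xA; rewrite /box leNgt xA mulr0n mul0r.
  - move=> x; rewrite normrM -[leRHS]mul1r ler_pM// /box.
    by case: (`|x| <= A); rewrite ?mulr1n ?mulr0n ?normr1 ?normr0.
by move=> x; rewrite kN /box normrN mulrN.
Qed.

Section Limits.
Variables (g : R -> R) (A B K : R).
Hypotheses (A0 : 0 < A) (mg : measurable_fun setT g) (sg : supported_in A g).
Hypothesis gB : forall x, `|g x| <= B.

Lemma Rintegral_zero_kernel (k0 : R -> R) : (forall x, k0 x = 0) ->
  \int[mu]_x ((g x - g 0) * box A x * k0 x) = 0.
Proof.
move=> k00; transitivity (\int[mu]_(x in [set: R]) (0 : R)).
  by apply: eq_Rintegral => x _; rewrite k00 mulr0.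
by rewrite /Rintegral integral0.
Qed.

(** The kernel is the derivative of [- x / (x^2 + e^2)], so its mass over [[-A, A]] is
    [- 2 A / (A^2 + e^2)], which converges although the kernel takes the value [- 1 / e^2] at 0. The
    quadratic bound on [g] offsets the double pole in the rest. *)
Lemma finite_part_limit : 0 <= K -> (forall x, `|g x - g 0| <= K * x ^+ 2) ->
  cvg (\int[mu]_x (g x * finite_part_kernel e x) @[e --> 0^'+]).
Proof.
move=> K0 gK; apply/cvg_ex; eexists.
have cq e : 0 < e -> continuous (finite_part_kernel e).
  move=> e0 x.
  apply: cvgM; first by apply: cvgB; [exact: exprn_continuous|exact: cvg_cst].
  apply: cvgV; first by rewrite expf_neq0// gt_eqF// sqrD_gt0.
  apply: (@cvg_comp _ _ _ _ (fun y : R => y ^+ 2)); last exact: exprn_continuous.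
  by apply: cvgD; [exact: exprn_continuous|exact: cvg_cst].
apply: (@kernel_cvg _ finite_part_kernel (fun x => x ^+ 2 / (x ^+ 2) ^+ 2)
  (fun x => x ^+ 2) g A B K 1 (- 2 * A / (A ^+ 2) ^+ 1)) => //.
- by move=> e e0; apply: continuous_measurable_fun; exact: cq.
- move=> e e0; exists (e ^+ 2)^-1 => x.
  apply: le_trans (finite_part_kernel_le x e0) _.
  by rewrite lef_pV2 ?posrE ?sqrD_gt0 ?exprn_gt0// lerDr sqr_ge0.
- move=> e x e0; have S0 := sqrD_gt0 x e0.
  apply: le_trans (ler_wpM2l (sqr_ge0 x) (finite_part_kernel_le x e0)) _.
  by rewrite ler_pdivrMr// mul1r lerDl sqr_ge0.
- move=> x x0; apply: (@cvg_over_sqrD _ (fun e => x ^+ 2 - e ^+ 2)) => //.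
  apply: cvg_at_right_of; last by rewrite expr0n subr0.
  by apply: cvgB; [exact: cvg_cst|exact: exprn_continuous].
- apply: (@cvg_trans _ ((fun e => - 2 * A / (A ^+ 2 + e ^+ 2) ^+ 1) @ 0^'+)).
    apply: near_eq_cvg; near=> e.
    have e0 : 0 < e by near: e; exact: nbhs_right_gt.
    have dF (x : R) : is_derive x (1 : R) (fun y : R => - y / (y ^+ 2 + e ^+ 2))
        (finite_part_kernel e x).
      have S0 := sqrD_gt0 x e0.
      have dN : is_derive x (1 : R) (fun y : R => - y) (- 1) by exact: is_deriveN.
      apply: (is_derive_eq (is_derive_div_sqrD e0 dN)).
      by rewrite /finite_part_kernel; field; rewrite gt_eqF.
    rewrite (Rintegral_box_FTC A0 dF (cq _ e0)).
    by rewrite sqrrN expr1; ring.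
  by apply: cvg_over_sqrD; [rewrite gt_eqF|exact: cvg_cst].
Unshelve. all: by end_near. Qed.

Hypotheses (K0 : 0 <= K) (gK : forall x, `|g x - g 0| <= K * `|x|).

Lemma poisson_limit :
  \int[mu]_x (g x * poisson_kernel e x) @[e --> 0^'+] --> pi * g 0.
Proof.
rewrite [X in _ --> X](_ : _ =
  \int[mu]_x ((g x - g 0) * box A x * 0) + g 0 * pi); last first.
  by rewrite Rintegral_zero_kernel// add0r mulrC.
apply: (@kernel_cvg _ _ (fun=> 0) (fun x => `|x|) g A B K 1 pi) => //.
- by move=> e e0; apply: continuous_measurable_fun; exact: continuous_poisson_kernel.
- move=> e e0; exists e^-1 => x.
  by rewrite ger0_norm ?poisson_kernel_le// poisson_kernel_ge0.
- move=> e x e0; rewrite (ger0_norm (poisson_kernel_ge0 _ _))//.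
  exact: poisson_kernel_leV.
- by move=> x; exact: cvg_poisson_kernel.
- apply: cvg_trans (cvg_2atan_div A0); apply: near_eq_cvg; near=> e.
  by rewrite Rintegral_poisson_kernel.
Unshelve. all: by end_near. Qed.

Lemma square_poisson_limit :
  \int[mu]_x (g x * square_poisson_kernel e x) @[e --> 0^'+] --> pi * g 0.
Proof.
rewrite [X in _ --> X](_ : _ =
  \int[mu]_x ((g x - g 0) * box A x * 0) + g 0 * pi); last first.
  by rewrite Rintegral_zero_kernel// add0r mulrC.
have cS e : 0 < e -> continuous (square_poisson_kernel e).
  move=> e0 x; apply: cvgM.
    by apply: cvgM; [exact: cvg_cst|exact: exprn_continuous].
  apply: cvgV; first by rewrite expf_neq0// gt_eqF// sqrD_gt0.
  apply: (@cvg_comp _ _ _ _ (fun y : R => y ^+ 2)); last exact: exprn_continuous.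
  by apply: cvgD; [exact: exprn_continuous|exact: cvg_cst].
apply: (@kernel_cvg _ _ (fun=> 0) (fun x => `|x|) g A B K 2 pi) => //.
- by move=> e e0; apply: continuous_measurable_fun; exact: cS.
- move=> e e0; exists (2 * e^-1) => x.
  have /andP[r0 r1] := square_poisson_kernel_le x e0.
  by rewrite ger0_norm// (le_trans r1)// ler_wpM2l// poisson_kernel_le.
- move=> e x e0; have /andP[r0 r1] := square_poisson_kernel_le x e0.
  rewrite (ger0_norm r0) (le_trans (ler_wpM2l _ r1))// mulrCA -[leRHS]mulr1.
  by rewrite ler_wpM2l// poisson_kernel_leV.
- move=> x x0; rewrite -[X in _ --> X](mul0r ((x ^+ 2) ^+ 2)^-1).
  apply: (@cvg_over_sqrD _ (fun e => 2 * e * x ^+ 2)) => //.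
  rewrite [X in _ --> X](_ : _ = 2 * 0 * x ^+ 2); last by ring.
  apply: cvgM; last exact: cvg_cst.
  by apply: cvgM; [exact: cvg_cst|exact: cvg_id_at_right0].
- rewrite -[X in _ --> X]subr0.
  apply: (@cvg_trans _ ((fun e => 2 * atan (A / e) -
      2 * A * e / (A ^+ 2 + e ^+ 2) ^+ 1) @ 0^'+)).
    apply: near_eq_cvg; near=> e.
    have e0 : 0 < e by near: e; exact: nbhs_right_gt.
    (* The arctangent carries the mass [pi] in the limit; the rational term tends to 0 at the
       endpoints. *)
    have dF (x : R) : is_derive x (1 : R)
        (fun y : R => atan (y / e) - y * e / (y ^+ 2 + e ^+ 2))
        (square_poisson_kernel e x).
      have S0 := sqrD_gt0 x e0.
      have dM : is_derive x (1 : R) (fun y : R => y * e) e.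
        have -> : (fun y : R => y * e) = (e \*: (id : R -> R)).
          by apply/funext => y; rewrite mulrC.
        by rewrite -[X in is_derive _ _ _ X]mulr1; exact: is_deriveZ.
      have H := is_deriveB (is_derive_atan_div x e0) (is_derive_div_sqrD e0 dM).
      apply: (is_derive_eq H).
      by rewrite /square_poisson_kernel /poisson_kernel; field; rewrite gt_eqF.
    rewrite (Rintegral_box_FTC A0 dF (cS _ e0)).
    by rewrite sqrrN expr1 mulNr atanN; ring.
  apply: cvgB; first exact: cvg_2atan_div.
  rewrite -[X in _ --> X](mul0r ((A ^+ 2) ^+ 1)^-1).
  apply: cvg_over_sqrD; first by rewrite gt_eqF.
  rewrite [X in _ --> X](_ : _ = 2 * A * 0); last by rewrite mulr0.
  by apply: cvgM; [exact: cvg_cst|exact: cvg_id_at_right0].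
Unshelve. all: by end_near. Qed.

(** The principal value of [g x / x] as an absolutely convergent integral: on a symmetric interval
    the subtracted constant contributes nothing, because [1 / x] is odd. *)
Definition centered_pv := \int[mu]_x ((g x - g 0) * box A x * x^-1).

Lemma conj_poisson_limit :
  \int[mu]_x (g x * conj_poisson_kernel e x) @[e --> 0^'+] --> centered_pv.
Proof.
rewrite -[X in _ --> X]addr0 -[X in _ + X](mulr0 (g 0)).
apply: (@kernel_cvg _ _ (fun x => x^-1) (fun x => `|x|) g A B K 1 0) => //.
- by move=> e; exact: measurable_conj_poisson_kernel.
- by move=> e e0; exists e^-1 => x; exact: conj_poisson_kernel_le.
- by move=> e x; exact: conj_poisson_kernel_leV.
- move=> x x0; rewrite [X in _ --> X](_ : _ = x / (x ^+ 2) ^+ 1); last by field.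
  by apply: (@cvg_over_sqrD _ (fun=> x)) => //; exact: cvg_cst.
- apply: (@cvg_trans _ ((fun=> 0 : R) @ (0 : R)^'+)); last exact: cvg_cst.
  apply: near_eq_cvg; near=> e.
  have e0 : 0 < e by near: e; exact: nbhs_right_gt.
  rewrite (@Rintegral_box_odd _ _ e^-1)//.
  + exact: measurable_conj_poisson_kernel.
  + by move=> x; exact: conj_poisson_kernel_le.
  + by move=> x; rewrite /conj_poisson_kernel sqrrN mulNr.
Unshelve. all: by end_near. Qed.

Lemma truncated_inv_limit :
  \int[mu]_x (g x * truncated_inv e x) @[e --> 0^'+] --> centered_pv.
Proof.
rewrite -[X in _ --> X]addr0 -[X in _ + X](mulr0 (g 0)).
apply: (@kernel_cvg _ _ (fun x => x^-1) (fun x => `|x|) g A B K 1 0) => //.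
- by move=> e _; exact: measurable_truncated_inv.
- by move=> e e0; exists e^-1 => x; exact: truncated_inv_le.
- by move=> e x _; exact: truncated_inv_leV.
- move=> x x0; apply: (@cvg_trans _ ((fun=> x^-1) @ (0 : R)^'+)); last exact: cvg_cst.
  apply: near_eq_cvg; near=> e; rewrite /truncated_inv.
  suff -> : e <= `|x| by rewrite mulr1n mul1r.
  by near: e; apply: nbhs_right_le; rewrite normr_gt0.
- apply: (@cvg_trans _ ((fun=> 0 : R) @ (0 : R)^'+)); last exact: cvg_cst.
  apply: near_eq_cvg; near=> e.
  have e0 : 0 < e by near: e; exact: nbhs_right_gt.
  rewrite (@Rintegral_box_odd _ _ e^-1)//.
  + exact: measurable_truncated_inv.
  + by move=> x; exact: truncated_inv_le.
  + by move=> x; rewrite /truncated_inv normrN invrN mulrN.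
Unshelve. all: by end_near. Qed.

End Limits.
End KernelLimits.

(** * Change of variables in a double integral *)

Section ChangeOfVariables.
Context {R : realType}.
Notation mu := (@lebesgue_measure R).
Notation mu2 := (mu \x mu)%E.

Section Box2.
Variables (w : R * R -> R) (A B : R).
Hypotheses (mw : measurable_fun setT w) (wB : forall p, `|w p| <= B).
Hypothesis sw : forall p, A < `|p.1| \/ A < `|p.2| -> w p = 0.

(** A bounded measurable function is integrable on a square, which has finite measure, and [w]
    vanishes off it. *)
Lemma integrable_box2 : mu2.-integrable setT (EFin \o w).
Proof.
pose S : set (measurableTypeR R * measurableTypeR R) :=
  (`[- A, A]%classic : set (measurableTypeR R)) `*` `[- A, A]%classic.
have mS : measurable S by apply: measurableX.
have -> : EFin \o w = (EFin \o w) \_ S.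
  apply/funext => -[x y]; rewrite patchE; case: ifPn => // /negP xyS /=.
  congr EFin; apply: sw; apply: contrapT => /not_orP[/= /negP xA /negP yA].
  apply: xyS; rewrite inE; split; rewrite /= in_itv/= -ler_norml.
  - by rewrite leNgt.
  - by rewrite leNgt.
apply: (integrable_mkcond (mu := mu2) (EFin \o w) mS).1; apply: measurable_bounded_integrable => //.
- rewrite [X in (X < _)%E]product_measure1E//.
  rewrite /= !lebesgue_measure_itv/=.
  by case: ifP => _; rewrite ?mule0// -EFinM ltry.
- exact: measurable_funTS.
- exists B; split; first exact: num_real.
  by move=> M BM p _ /=; rewrite (le_trans (wB _))// ltW.
Qed.

Lemma integrable_box2_section1 y : mu.-integrable setT (EFin \o (fun x => w (x, y))).
Proof.
apply: (@integrable_supported _ A B).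
- exact: measurable_fun_pair1.
- by move=> x xA; apply: sw; left.
- by move=> x.
Qed.

Lemma integrable_box2_section2 x : mu.-integrable setT (EFin \o (fun y => w (x, y))).
Proof.
apply: (@integrable_supported _ A B).
- exact: measurable_fun_pair2.
- by move=> y yA; apply: sw; right.
- by move=> y.
Qed.

Lemma Rintegral_box2_21 :
  \int[mu2]_p w p = \int[mu]_y \int[mu]_x w (x, y).
Proof.
rewrite /Rintegral; congr fine.
rewrite -(integral21_prod_meas1 integrable_box2).
apply: eq_integral => y _; rewrite /fubini_G fineK//.
exact: integrable_fin_num (integrable_box2_section1 y).
Qed.

Lemma Rintegral_box2_12 :
  \int[mu2]_p w p = \int[mu]_x \int[mu]_y w (x, y).
Proof.
rewrite /Rintegral; congr fine.
rewrite -(integral12_prod_meas1 integrable_box2).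
apply: eq_integral => x _; rewrite /fubini_F fineK//.
exact: integrable_fin_num (integrable_box2_section2 x).
Qed.

End Box2.

Lemma measurable_fun_shear c : measurable_fun setT
  (fun p : R * R => (p.1 + p.2 + c, p.2)).
Proof.
apply: measurable_fun_pair; last exact: measurable_snd.
apply: measurable_funD; last exact: measurable_cst.
by apply: measurable_funD; [exact: measurable_fst|exact: measurable_snd].
Qed.

(** Translations in one variable suffice. For fixed second variable [y] the first is shifted by
    [y - c], the order of integration is exchanged, and for fixed [x] the second variable is shifted
    by [c - x / 2]. The new variable [x] is the difference of the two arguments plus [c]. *)
Lemma Rintegral_sum_difference (w : R * R -> R) (A B c : R) :
  measurable_fun setT w -> (forall p, `|w p| <= B) ->
  (forall p, A < `|p.1| \/ A < `|p.2| -> w p = 0) ->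
  \int[mu2]_p w p =
  \int[mu]_x \int[mu]_z w (z + x / 2, z - x / 2 + c).
Proof.
move=> mw wB sw; rewrite (Rintegral_box2_21 mw wB sw).
pose v (p : R * R) := w (p.1 + p.2 - c, p.2).
have mv : measurable_fun setT v by exact: measurableT_comp (measurable_fun_shear (- c)).
have vB p : `|v p| <= B by exact: wB.
(* The shear enlarges the supporting square: [p.1] is the sheared coordinate minus [p.2] plus [c].
   Absolute values appear because the sign of [A] is unspecified. *)
have sv (p : R * R) : `|A| + `|A| + `|c| < `|p.1| \/ `|A| + `|A| + `|c| < `|p.2| ->
    v p = 0.
  have A0 : A <= `|A| by exact: ler_norm.
  have nc : 0 <= `|c| by [].
  have nA : 0 <= `|A| by [].
  case=> pA; apply: sw => /=.
    have [p2|] := leP `|p.2| A; last by right.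
    left; rewrite ltNge; apply/negP => p1.
    have : `|p.1| <= `|p.1 + p.2 - c| + `|p.2| + `|c|.
      rewrite [X in `|X|](_ : p.1 = p.1 + p.2 - c - p.2 + c); last by ring.
      by rewrite (le_trans (ler_normD _ _))// lerD2r (le_trans (ler_normB _ _)).
    lra.
  right; lra.
transitivity (\int[mu]_y \int[mu]_x v (x, y)).
  apply: eq_Rintegral => y _.
  rewrite -[LHS](@Rintegral_shift _ _ (y - c)); last exact: measurable_fun_pair1.
  by apply: eq_Rintegral => x _; rewrite /v/= addrA.
rewrite -(Rintegral_box2_21 mv vB sv) (Rintegral_box2_12 mv vB sv).
apply: eq_Rintegral => x _.
rewrite -[LHS](@Rintegral_shift _ _ (c - x / 2)); last exact: measurable_fun_pair2.
by apply: eq_Rintegral => z _; rewrite /v/=; congr (w (_, _)); field.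
Qed.

End ChangeOfVariables.

(** * Overlap integrals *)

Section SwitchingFunction.
Context {R : realType}.
Notation mu := (@lebesgue_measure R).

(** The Lipschitz constant is the maximum of the modulus of the derivative on [[-T, T]]; it bounds
    the derivative everywhere, and the mean value theorem concludes. *)
Lemma C1_supported_lipschitz (f : R -> R) (T : R) : 0 < T ->
  (forall t : R, derivable f t 1) -> continuous (derive1 f) ->
  supported_in T f ->
  exists2 K : R, 0 <= K & forall x y, `|f x - f y| <= K * `|x - y|.
Proof.
move=> T0 df cf sf.
have [||c _ cmax] := @EVT_max R (fun x => `|derive1 f x|) (- T) T.
- by lra.
- apply: continuous_subspaceT => x.
  by apply: continuous_comp; [exact: cf|exact: norm_continuous].
have f'K x : `|derive1 f x| <= `|derive1 f c|.
  have [xT|xT] := leP `|x| T; first by apply: cmax; rewrite in_itv/= -ler_norml.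
  rewrite (_ : derive1 f x = 0) ?normr0//.
  (* The condition [T < |x|] is open, so [f] is zero on a whole neighbourhood of [x]. *)
  rewrite derive1E (@near_eq_derive _ _ _ f (cst 0))//; first by rewrite derive_cst.
  near=> y; apply: sf; near: y.
  have cn : (fun y : R => `|y|) y @[y --> x] --> `|x| by exact: norm_continuous.
  exact: (cvgr_gt _ cn).
exists `|derive1 f c| => //.
have cR : continuous f.
  by move=> x; apply/differentiable_continuous/derivable1_diffP.
suff lt_lip x y : x <= y -> `|f x - f y| <= `|derive1 f c| * `|x - y|.
  move=> x y; have [|/ltW] := leP x y; first exact: lt_lip.
  by rewrite distrC [`|x - y|]distrC; exact: lt_lip.
move=> xy; rewrite distrC [`|x - y|]distrC.
have [||z _ ->] := @MVT_segment R f (derive1 f) x y xy.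
- by move=> z _; rewrite derive1E; exact/derivableP.
- exact: continuous_subspaceT.
by rewrite normrM ler_wpM2r.
Unshelve. all: by end_near. Qed.

Lemma lipschitz_supported_bounded (f : R -> R) (T K : R) : 0 < T -> 0 <= K ->
  (forall x y, `|f x - f y| <= K * `|x - y|) -> supported_in T f ->
  forall x, `|f x| <= K * (2 * T + 1).
Proof.
move=> T0 K0 fK sf x.
(* A zero of [f] at distance at most [2 * T + 1] from every point of [[-T, T]]. *)
have fT : f (T + 1) = 0 by apply: sf; rewrite gtr0_norm; lra.
have [xT|xT] := leP `|x| T; last first.
  by rewrite sf// normr0 mulr_ge0//; lra.
rewrite -[f x]subr0 -fT (le_trans (fK _ _))// ler_wpM2l//.
by move: xT; rewrite !ler_norml; lra.
Qed.

Lemma lipschitz_continuous (f : R -> R) (M : R) :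
  (forall x y, `|f x - f y| <= M * `|x - y|) -> continuous f.
Proof.
move=> fM x; apply/cvgrPdist_lt => e e0.
have M0 : 0 < `|M| + 1 by rewrite ltr_wpDl.
have eM0 : 0 < e / (`|M| + 1) by rewrite divr_gt0.
near=> y; apply: le_lt_trans (fM _ _) _.
apply: (@le_lt_trans _ _ ((`|M| + 1) * `|x - y|)).
  by rewrite ler_wpM2r// (le_trans (ler_norm M))// lerDl.
rewrite mulrC -ltr_pdivlMr//; by near: y.
Unshelve. all: by end_near. Qed.

Section Overlap.
Variables (T K B : R) (chi : R -> R).
Hypotheses (T0 : 0 < T) (K0 : 0 <= K).
Hypothesis chi_lip : forall x y, `|chi x - chi y| <= K * `|x - y|.
Hypothesis chiB : forall x, `|chi x| <= B.
Hypothesis sc : supported_in T chi.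

Let B0 : 0 <= B. Proof. exact: le_trans (chiB 0). Qed.

Lemma measurable_switching : measurable_fun setT chi.
Proof. by apply: continuous_measurable_fun; exact: lipschitz_continuous chi_lip. Qed.

Lemma measurable_switching_shift (c : R) :
  measurable_fun setT (fun z : R => chi (z + c)).
Proof.
apply: (measurableT_comp measurable_switching).
by apply: measurable_funD; [exact: measurable_id|exact: measurable_cst].
Qed.

(** The weight [cos (2 * Omega * z)] gives [C_overlap Omega chi], the weight 1 gives the
    autocorrelation of [chi] that governs [P_exc], and shifted sines and cosines arise from the
    phase in [M_reg]. *)
Definition overlap (a : R -> R) (x : R) :=
  \int[mu]_z (chi (z + x / 2) * chi (z - x / 2) * a z).

Section Weight.
Variable a : R -> R.
Hypotheses (ma : measurable_fun setT a) (a1 : forall z, `|a z| <= 1).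

Lemma measurable_overlap_integrand (x : R) :
  measurable_fun setT (fun z : R => chi (z + x / 2) * chi (z - x / 2) * a z).
Proof.
apply: measurable_funM => //.
by apply: measurable_funM; exact: measurable_switching_shift.
Qed.

Lemma supported_overlap_integrand x :
  supported_in T (fun z => chi (z + x / 2) * chi (z - x / 2) * a z).
Proof.
move=> z zT; have [|/sc ->] := leP `|z + x / 2| T; last by rewrite !mul0r.
have [|/sc ->] := leP `|z - x / 2| T; last by rewrite mulr0 mul0r.
by move: zT; rewrite ltNge ler_norml => /negP zT; rewrite !ler_norml; lra.
Qed.

Lemma overlap_integrand_le x z :
  `|chi (z + x / 2) * chi (z - x / 2) * a z| <= B * B.
Proof.
by rewrite -[leRHS]mulr1 !normrM ler_pM// ?mulr_ge0// ler_pM.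
Qed.

Lemma integrable_overlap x : mu.-integrable setT
  (EFin \o (fun z => chi (z + x / 2) * chi (z - x / 2) * a z)).
Proof.
apply: (integrable_supported (measurable_overlap_integrand x)
  (supported_overlap_integrand x) (overlap_integrand_le x)).
Qed.

Lemma overlap_le x : `|overlap a x| <= 2 * T * (B * B).
Proof.
apply: normr_Rintegral_le; first exact: ltW.
- exact: measurable_overlap_integrand.
- exact: supported_overlap_integrand.
- exact: overlap_integrand_le.
Qed.

Lemma supported_overlap : supported_in (2 * T) (overlap a).
Proof.
move=> x xT; rewrite /overlap /Rintegral integral0_eq// => z _.
congr EFin; have [|/sc ->] := leP `|z + x / 2| T; last by rewrite !mul0r.
have [|/sc ->] := leP `|z - x / 2| T; last by rewrite mulr0 mul0r.
by move: xT; rewrite ltNge ler_norml => /negP xT; rewrite !ler_norml; lra.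
Qed.

(** Telescoping the product gives two terms. In each, one factor moves by [|x - y| / 2] in its
    argument and the other is at most [B], so together they contribute [K * B * |x - y|] on an
    interval of length [2 * T]. *)
Lemma overlap_lip x y : `|overlap a x - overlap a y| <= 2 * T * (K * B) * `|x - y|.
Proof.
rewrite /overlap -RintegralB//; try exact: integrable_overlap.
rewrite -mulrA; apply: normr_Rintegral_le; first exact: ltW.
- by apply: measurable_funB; exact: measurable_overlap_integrand.
- by move=> z zT; rewrite !supported_overlap_integrand// subrr.
move=> z; rewrite -mulrBl normrM -[leRHS]mulr1 ler_pM//.
rewrite (_ : _ - _ = (chi (z + x / 2) - chi (z + y / 2)) * chi (z - x / 2) +
  chi (z + y / 2) * (chi (z - x / 2) - chi (z - y / 2))); last by ring.
rewrite (le_trans (ler_normD _ _))// !normrM.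
have h1 : `|chi (z + x / 2) - chi (z + y / 2)| <= K * (`|x - y| / 2).
  apply: le_trans (chi_lip _ _) _.
  by rewrite (_ : _ - _ = (x - y) / 2) ?normrM ?(@ger0_norm _ 2^-1)//; field.
have h2 : `|chi (z - x / 2) - chi (z - y / 2)| <= K * (`|x - y| / 2).
  apply: le_trans (chi_lip _ _) _.
  rewrite (_ : _ - _ = - ((x - y) / 2)); last by field.
  by rewrite normrN normrM (@ger0_norm _ 2^-1).
have e1 := ler_pM (normr_ge0 _) (normr_ge0 _) h1 (chiB (z - x / 2)).
have e2 := ler_pM (normr_ge0 _) (normr_ge0 _) (chiB (z + y / 2)) h2.
by apply: le_trans (lerD e1 e2) _; rewrite le_eqVlt; apply/orP; left; apply/eqP; field.
Qed.

Lemma continuous_overlap : continuous (overlap a).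
Proof. exact: lipschitz_continuous overlap_lip. Qed.

Lemma measurable_overlap : measurable_fun setT (overlap a).
Proof. by apply: continuous_measurable_fun; exact: continuous_overlap. Qed.

End Weight.

(* Polarization, chi(z+h) chi(z-h) = (chi(z+h)^2 + chi(z-h)^2) / 2 - (chi(z+h) -
   chi(z-h))^2 / 2, makes the difference quadratic in [x] although chi is only
   Lipschitz here. *)
Lemma overlap1_quadratic x :
  `|overlap (fun=> 1) x - overlap (fun=> 1) 0| <=
    (2 * T * (K * K) + B * B / (2 * T)) * x ^+ 2.
Proof.
have solve (u v w : R) : 2 * u = 2 * v + w -> v - u = - (2^-1 * w) by lra.
have x20 := sqr_ge0 x.
have KK0 : 0 <= 2 * T * (K * K) by rewrite !mulr_ge0// ltW.
have BB0 : 0 <= B * B / (2 * T) by rewrite !divr_ge0 ?mulr_ge0// ltW.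
(* Beyond [2 * T] only the value at 0 survives. It is at most [2 * T * B^2], that is [B^2 / (2 * T)]
   times [(2 * T)^2]: hence the second summand of the constant. *)
have [xT|xT] := leP `|x| (2 * T); last first.
  rewrite supported_overlap// sub0r normrN.
  apply: le_trans (overlap_le _ _ 0) _ => //; first by move=> _; rewrite normr1.
  apply: (@le_trans _ _ (B * B / (2 * T) * (2 * T) ^+ 2)).
    by rewrite le_eqVlt; apply/orP; left; apply/eqP; field; rewrite gt_eqF.
  rewrite [leRHS]mulrDl; apply: ler_wpDl; first exact: mulr_ge0.
  rewrite ler_wpM2l//.
  by rewrite -[leRHS](real_normK (num_real x)); have := ltW T0; nra.
pose d z := (chi (z + x / 2) - chi (z - x / 2)) ^+ 2.
have md : measurable_fun setT d.
  apply: measurable_funX; apply: measurable_funB; exact: measurable_switching_shift.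
(* Here [|x| / 2 <= T], so both arguments of [chi] exceed [T] in modulus once [|z| > 2 * T]. *)
have sd : supported_in (2 * T) d.
  move=> z zT; rewrite /d !sc ?subrr ?expr0n//.
    by rewrite ltNge ler_norml; apply/negP; move: zT xT;
      rewrite ltNge !ler_norml => /negP; lra.
  by rewrite ltNge ler_norml; apply/negP; move: zT xT;
    rewrite ltNge !ler_norml => /negP; lra.
have dK z : `|d z| <= K * K * x ^+ 2.
  rewrite /d normrX -expr2 -exprMn -(real_normK (num_real (K * x))).
  rewrite lerXn2r ?nnegrE ?normr_ge0// normrM (ger0_norm K0).
  apply: le_trans (chi_lip _ _) _.
  by rewrite (_ : _ - _ = x)//; field.
have sq_shift c : \int[mu]_z (chi (z + c) ^+ 2) = \int[mu]_z (chi z ^+ 2).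
  rewrite (@Rintegral_shift _ (fun z => chi z ^+ 2))//.
  by apply: measurable_funX; exact: measurable_switching.
have isq c : mu.-integrable setT (EFin \o (fun z => chi (z + c) ^+ 2)).
  apply: (@integrable_supported _ (T + `|c|) (B ^+ 2)).
  - by apply: measurable_funX; exact: measurable_switching_shift.
  - move=> z zT; rewrite sc ?expr0n//.
    have : `|z| <= `|z + c| + `|c| by rewrite -{1}(addrK c z) ler_normB.
    lra.
  - by move=> z; rewrite normrX lerXn2r ?nnegrE.
have m1 : measurable_fun setT (fun _ : R => 1 : R) by exact: measurable_cst.
have n1 (z : R) : `|1 : R| <= 1 by rewrite normr1.
have iov := integrable_overlap m1 n1 x.
have i2 : mu.-integrable setT
    (EFin \o (fun z => 2 * (chi (z + x / 2) * chi (z - x / 2) * 1))).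
  have := integrableZl measurableT 2 iov.
  by apply: eq_integrable => // z _ /=; rewrite EFinM.
have intd := integrable_supported md sd dK.
have D0 : overlap (fun=> 1) 0 = \int[mu]_z (chi z ^+ 2).
  by apply: eq_Rintegral => z _; rewrite mul0r addr0 subr0 mulr1 expr2.
(* The polarization identity integrated over [z]; by translation invariance both squares have the
   integral of [chi^2]. *)
have key : 2 * \int[mu]_z (chi z ^+ 2) =
    2 * overlap (fun=> 1) x + \int[mu]_z d z.
  rewrite /overlap -[X in _ = X + _](RintegralZl _ _ iov)// -[RHS]RintegralD//.
  rewrite mulr_natl mulr2n -[X in X + _](sq_shift (x / 2)).
  rewrite -[X in _ + X](sq_shift (- (x / 2))) -RintegralD//.
  by apply: eq_Rintegral => z _; rewrite /d; ring.
rewrite D0 (solve _ _ _ key) normrN normrM (@ger0_norm _ 2^-1)//.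
have T20 : 0 <= 2 * T by rewrite mulr_ge0// ltW.
(* Half the integral of [d], which is at most [K^2 x^2] on an interval of length [4 * T]: this is
   the first summand of the constant. *)
apply: (@le_trans _ _ (2^-1 * (2 * (2 * T) * (K * K * x ^+ 2)))).
  by rewrite ler_wpM2l// normr_Rintegral_le.
rewrite [leRHS]mulrDl; apply: ler_wpDr; first exact: mulr_ge0.
by rewrite le_eqVlt; apply/orP; left; apply/eqP; field.
Qed.

End Overlap.
End SwitchingFunction.

(** * Pole limits *)

Section OverlapIntegrals.
Context {R : realType}.
Notation mu := (@lebesgue_measure R).
Notation mu2 := (mu \x mu)%E.
Variables (T K B : R) (chi : R -> R).
Hypotheses (T0 : 0 < T) (K0 : 0 <= K).
Hypothesis chi_lip : forall x y, `|chi x - chi y| <= K * `|x - y|.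
Hypothesis chiB : forall x, `|chi x| <= B.
Hypothesis sc : supported_in T chi.

Let B0 : 0 <= B. Proof. exact: le_trans (chiB 0). Qed.

Section Fubini.
Variables (a k : R -> R) (M s : R).
Hypotheses (ma : measurable_fun setT a) (a1 : forall x, `|a x| <= 1).
Hypotheses (mk : measurable_fun setT k) (kM : forall x, `|k x| <= M).

Let w (p : R * R) := chi p.1 * chi (p.2 - s) * a (p.1 + p.2) * k (p.1 - p.2).

Let mw : measurable_fun setT w.
Proof.
apply: measurable_funM; first apply: measurable_funM; first apply: measurable_funM.
- exact: (measurableT_comp (measurable_switching chi_lip) measurable_fst).
- apply: (measurableT_comp (measurable_switching chi_lip)).
  by apply: measurable_funB; [exact: measurable_snd|exact: measurable_cst].
- apply: (measurableT_comp ma).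
  by apply: measurable_funD; [exact: measurable_fst|exact: measurable_snd].
- apply: (measurableT_comp mk).
  by apply: measurable_funB; [exact: measurable_fst|exact: measurable_snd].
Qed.

Let wB p : `|w p| <= B * B * 1 * M.
Proof. by rewrite !normrM !ler_pM// !mulr_ge0. Qed.

Let sw (p : R * R) : T + `|s| < `|p.1| \/ T + `|s| < `|p.2| -> w p = 0.
Proof.
case=> pT; rewrite /w.
  by rewrite sc ?mul0r// (le_lt_trans _ pT)// lerDl.
rewrite (sc (x := p.2 - s)) ?mulr0 ?mul0r//.
have : `|p.2| <= `|p.2 - s| + `|s| by rewrite -{1}(subrK s p.2) ler_normD.
by lra.
Qed.

Lemma integrable_two_time : mu2.-integrable setT (EFin \o
  (fun p => chi p.1 * chi (p.2 - s) * a (p.1 + p.2) * k (p.1 - p.2))).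
Proof. exact: (integrable_box2 mw wB sw). Qed.

(** In the new variables the sum of the times is [2 * z + s] and their difference is [x - s], so the
    kernel leaves the inner integral and an overlap remains. *)
Lemma Rintegral_two_time :
  \int[mu2]_p (chi p.1 * chi (p.2 - s) * a (p.1 + p.2) * k (p.1 - p.2)) =
  \int[mu]_x (overlap chi (fun z => a (2 * z + s)) x * k (x - s)).
Proof.
rewrite (Rintegral_sum_difference s mw wB sw); apply: eq_Rintegral => x _.
have ma' : measurable_fun setT (fun z : R => a (2 * z + s)).
  apply: (measurableT_comp ma); apply: measurable_funD; last exact: measurable_cst.
  by apply: measurable_funM; [exact: measurable_cst|exact: measurable_id].
rewrite /overlap -RintegralZr//.
  apply: eq_Rintegral => z _; rewrite /w/= addrK; congr (_ * a _ * k _); first by field.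
  by field.
exact: (integrable_overlap chi_lip chiB sc ma').
Qed.

End Fubini.

Lemma Rintegral_reflect (f k : R -> R) (c : R) :
  measurable_fun setT f -> measurable_fun setT k ->
  \int[mu]_x (f x * k (c - x)) = \int[mu]_x (f (c - x) * k x).
Proof.
move=> mf mk; pose h x := f (c - x) * k x.
have mc : measurable_fun setT (fun x : R => c - x).
  by apply: measurable_funB; [exact: measurable_cst|exact: measurable_id].
have mh : measurable_fun setT h.
  by apply: measurable_funM => //; exact: measurableT_comp.
rewrite -(Rintegral_opp mh) -(@Rintegral_shift _ (fun x => h (- x)) (- c)).
  by apply: eq_Rintegral => x _; rewrite /h opprD opprK addrC; congr (f _ * k _); ring.
exact: (measurableT_comp mh).
Qed.

Lemma Rintegral_translate (f k : R -> R) (c : R) :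
  measurable_fun setT f -> measurable_fun setT k ->
  \int[mu]_x (f x * k (c + x)) = \int[mu]_x (f (x - c) * k x).
Proof.
move=> mf mk; rewrite -[RHS](@Rintegral_shift _ _ c).
  by apply: eq_Rintegral => x _; rewrite addrK (addrC c).
apply: measurable_funM => //; apply: (measurableT_comp mf).
by apply: measurable_funB; [exact: measurable_id|exact: measurable_cst].
Qed.

End OverlapIntegrals.

(** * A pair of simple poles and its principal value *)

Section PoleLimits.
Context {R : realType}.
Notation mu := (@lebesgue_measure R).
Variables (A B K L s : R) (C : R -> R).
Hypotheses (A0 : 0 < A) (K0 : 0 <= K) (L0 : 0 < L).
Hypothesis C_lip : forall x y, `|C x - C y| <= K * `|x - y|.
Hypothesis CB : forall x, `|C x| <= B.
Hypothesis sC : supported_in A C.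

Let A' := A + `|s| + L.
Let A'0 : 0 < A'. Proof. by rewrite ltr_wpDr ?ltW// ltr_wpDr. Qed.

(** [g1] and [g2] recentre [C] at the poles [s + L] and [s - L]: their variables are
    [L - (zeta - s)] and [L + (zeta - s)], so each pole moves to 0. Both functions vanish off
    [[-A', A']]. *)
Let g1 x := C (s + L - x).
Let g2 x := C (x - (L - s)).

Let mC : measurable_fun setT C.
Proof. by apply: continuous_measurable_fun; exact: lipschitz_continuous C_lip. Qed.

Let mg1 : measurable_fun setT g1.
Proof.
apply: (measurableT_comp mC).
by apply: measurable_funB; [exact: measurable_cst|exact: measurable_id].
Qed.

Let mg2 : measurable_fun setT g2.
Proof.
apply: (measurableT_comp mC).
by apply: measurable_funB; [exact: measurable_id|exact: measurable_cst].
Qed.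

Let sg1 : supported_in A' g1.
Proof.
move=> x xA; apply: sC; move: xA; rewrite /A'.
have : `|x| <= `|s + L - x| + (`|s| + `|L|).
  rewrite -{1}(subKr (s + L) x) (le_trans (ler_normB _ _))// addrC lerD2l.
  exact: ler_normD.
by rewrite (gtr0_norm L0); lra.
Qed.

Let sg2 : supported_in A' g2.
Proof.
move=> x xA; apply: sC; move: xA; rewrite /A'.
have : `|x| <= `|x - (L - s)| + (`|L| + `|s|).
  rewrite -{1}(subrK (L - s) x) (le_trans (ler_normD _ _))// lerD2l.
  exact: ler_normB.
by rewrite (gtr0_norm L0); lra.
Qed.

Let g1K x : `|g1 x - g1 0| <= K * `|x|.
Proof.
apply: le_trans (C_lip _ _) _.
by rewrite (_ : _ - _ = - x) ?normrN//; ring.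
Qed.

Let g2K x : `|g2 x - g2 0| <= K * `|x|.
Proof.
apply: le_trans (C_lip _ _) _.
by have -> : x - (L - s) - (0 - (L - s)) = x by ring.
Qed.

(** By [1 / (L^2 - u^2) = (2 L)^-1 (1 / (L - u) + 1 / (L + u))], this is [2 * L] times the principal
    value of the theorem. *)
Definition pole_pv := centered_pv (fun x => C (s + L - x)) (A + `|s| + L) +
  centered_pv (fun x => C (x - (L - s))) (A + `|s| + L).

Lemma Rintegral_two_poles (k : R -> R) M :
  measurable_fun setT k -> (forall x, `|k x| <= M) ->
  \int[mu]_x (C x * (k (L - (x - s)) + k (L + (x - s)))) =
  \int[mu]_x (g1 x * k x) + \int[mu]_x (g2 x * k x).
Proof.
move=> mk kM.
have B0 : 0 <= B by exact: le_trans (CB 0).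
rewrite -(Rintegral_reflect (s + L) mC mk) -(Rintegral_translate (L - s) mC mk).
have ic (phi : R -> R) : measurable_fun setT phi ->
    mu.-integrable setT (EFin \o (fun x => C x * k (phi x))).
  move=> mphi; apply: (@integrable_supported _ A (B * M)).
  - by apply: measurable_funM => //; exact: measurableT_comp.
  - by move=> x xA; rewrite sC// mul0r.
  - by move=> x; rewrite normrM ler_pM.
rewrite -RintegralD//.
- apply: eq_Rintegral => x _; rewrite mulrDr; congr (_ * k _ + _ * k _); ring.
- by apply: ic; apply: measurable_funB; [exact: measurable_cst|exact: measurable_id].
- by apply: ic; apply: measurable_funD; [exact: measurable_cst|exact: measurable_id].
Qed.

Lemma two_pole_conj_poisson_limit :
  \int[mu]_x (C x * (conj_poisson_kernel e (L - (x - s)) +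
                     conj_poisson_kernel e (L + (x - s)))) @[e --> 0^'+] -->
  pole_pv.
Proof.
apply: (@cvg_trans _ ((fun e => \int[mu]_x (g1 x * conj_poisson_kernel e x) +
    \int[mu]_x (g2 x * conj_poisson_kernel e x)) @ 0^'+)).
  apply: near_eq_cvg; near=> e.
  have e0 : 0 < e by near: e; exact: nbhs_right_gt.
  rewrite (@Rintegral_two_poles _ e^-1)//.
  - exact: measurable_conj_poisson_kernel.
  - by move=> x; exact: conj_poisson_kernel_le.
apply: cvgD.
- exact: (conj_poisson_limit mg1 sg1 (fun x => CB _) K0 g1K).
- exact: (conj_poisson_limit mg2 sg2 (fun x => CB _) K0 g2K).
Unshelve. all: by end_near. Qed.

Lemma two_pole_poisson_limit :
  \int[mu]_x (C x * (poisson_kernel e (L - (x - s)) +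
                     poisson_kernel e (L + (x - s)))) @[e --> 0^'+] -->
  pi * (C (s + L) + C (s - L)).
Proof.
have -> : pi * (C (s + L) + C (s - L)) = pi * g1 0 + pi * g2 0.
  by rewrite /g1 /g2 mulrDr subr0 sub0r opprB.
apply: (@cvg_trans _ ((fun e => \int[mu]_x (g1 x * poisson_kernel e x) +
    \int[mu]_x (g2 x * poisson_kernel e x)) @ 0^'+)).
  apply: near_eq_cvg; near=> e.
  have e0 : 0 < e by near: e; exact: nbhs_right_gt.
  rewrite (@Rintegral_two_poles _ e^-1)//.
  - by apply: continuous_measurable_fun; exact: continuous_poisson_kernel.
  - by move=> x; rewrite ger0_norm ?poisson_kernel_le// poisson_kernel_ge0.
apply: cvgD.
- exact: (poisson_limit A'0 mg1 sg1 (fun x => CB _) K0 g1K).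
- exact: (poisson_limit A'0 mg2 sg2 (fun x => CB _) K0 g2K).
Unshelve. all: by end_near. Qed.

(** The argument of the kernel is at least [L], so [1 / L] bounds the kernel uniformly in [e]. *)
Lemma regular_poisson_limit :
  \int[mu]_x (C x * poisson_kernel e (L + `|x - s|)) @[e --> 0^'+] --> 0.
Proof.
have B0 : 0 <= B by exact: le_trans (CB 0).
have Ln x : 0 < L + `|x - s| by rewrite ltr_wpDr.
rewrite [X in _ --> X](_ : _ = \int[mu]_(x in [set: R]) (0 : R)); last first.
  by rewrite /Rintegral integral0.
apply: (@Rintegral_cvg_at_right0 _ _ _ (fun x => B * L^-1 * box A x)).
- move=> e e0; apply: measurable_funM => //.
  apply: (measurableT_comp (continuous_measurable_fun
    (continuous_poisson_kernel e0))).
  apply: measurable_funD; first exact: measurable_cst.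
  apply: continuous_measurable_fun => x; apply: cvg_norm.
  by apply: cvgB; [exact: cvg_id|exact: cvg_cst].
- exact: integrable_box.
- move=> e x e0; apply: (@supported_le_box _ A (B * L^-1)
    (fun x => C x * poisson_kernel e (L + `|x - s|))) => [y yA|y].
    by rewrite sC// mul0r.
  rewrite normrM ler_pM// ger0_norm ?poisson_kernel_ge0//.
  have := poisson_kernel_leV (L + `|y - s|) e0; rewrite (gtr0_norm (Ln y)).
  rewrite mulrC -ler_pdivlMr// mul1r => /le_trans; apply.
  by rewrite lef_pV2 ?posrE ?lerDl ?Ln.
- move=> x; rewrite [X in _ --> X](_ : _ = C x * 0); last by rewrite mulr0.
  apply: cvgM; first exact: cvg_cst.
  by apply: cvg_poisson_kernel; rewrite gt_eqF.
Qed.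

(** The principal value deletes both balls from the full integrand. If [x] is one of [L - u],
    [L + u], then [2 * L - x] is the other, so inside the ball of one pole the second term cancels
    the summand belonging to the other. Hence [k' e (L - u) + k' e (L + u)] vanishes on both balls,
    even when these overlap. *)
Let k' e x := truncated_inv e x - (`|x| < e)%R%:R * truncated_inv e (2 * L - x).

Let mk' e : measurable_fun setT (k' e).
Proof.
apply: measurable_funB; first exact: measurable_truncated_inv.
apply: measurable_funM.
  have -> : (fun x => (`|x| < e)%R%:R) = (fun x : R => 1 - (e <= `|x|)%R%:R : R).
    by apply/funext => x; case: leP; rewrite ?mulr1n ?mulr0n ?subrr ?subr0.
  apply: measurable_funB; first exact: measurable_cst.
  by apply: measurable_le_indic; [exact: measurable_cst|exact: normr_measurable].
apply: (measurableT_comp (measurable_truncated_inv e)).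
by apply: measurable_funB; [exact: measurable_cst|exact: measurable_id].
Qed.

Lemma ball_indicator_le (e x : R) : `|(`|x| < e)%R%:R| <= 1 :> R.
Proof. by case: (`|x| < e); rewrite ?mulr1n ?mulr0n ?normr1 ?normr0. Qed.

Let k'_le e : 0 < e -> forall x, `|k' e x| <= e^-1 + e^-1.
Proof.
move=> e0 x; rewrite (le_trans (ler_normB _ _))// lerD ?truncated_inv_le//.
rewrite -[leRHS]mul1r normrM ler_pM ?truncated_inv_le//.
exact: ball_indicator_le.
Qed.

Let near_pole_le e x : 0 < e -> e < L ->
  `|(`|x| < e)%R%:R * truncated_inv e (2 * L - x)| <= L^-1.
Proof.
move=> e0 eL; have [xe|_] := ltP `|x| e; last first.
  by rewrite mulr0n mul0r normr0 invr_ge0 ltW.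
rewrite mulr1n mul1r.
have Lx : L <= `|2 * L - x|.
  by rewrite (le_trans _ (ler_norm _))//; move: xe; rewrite ltr_norml; lra.
have := truncated_inv_leV e (2 * L - x).
rewrite mulrC -ler_pdivlMr ?(lt_le_trans L0)// mul1r => /le_trans; apply.
by rewrite lef_pV2 ?posrE ?(lt_le_trans L0).
Qed.

Let k'_limit (g : R -> R) : measurable_fun setT g ->
  supported_in A' g -> (forall x, `|g x| <= B) ->
  (forall x, `|g x - g 0| <= K * `|x|) ->
  \int[mu]_x (g x * k' e x) @[e --> 0^'+] --> centered_pv g A'.
Proof.
move=> mg sg gB gK.
have B0 : 0 <= B by exact: le_trans (gB 0).
pose q e x : R := (`|x| < e)%R%:R * truncated_inv e (2 * L - x).
have mq e : measurable_fun setT (q e).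
  have -> : q e = (fun x => truncated_inv e x - k' e x).
    by apply/funext => x; rewrite /k' subKr.
  by apply: measurable_funB; [exact: measurable_truncated_inv|exact: mk'].
rewrite -[X in _ --> X]subr0.
apply: (@cvg_trans _ ((fun e => \int[mu]_x (g x * truncated_inv e x) -
    \int[mu]_x (g x * q e x)) @ 0^'+)).
  apply: near_eq_cvg; near=> e.
  have e0 : 0 < e by near: e; exact: nbhs_right_gt.
  have eL : e < L by near: e; exact: nbhs_right_lt.
  rewrite -RintegralB//.
  - by apply: eq_Rintegral => x _; rewrite /k' mulrBr.
  - apply: (@integrable_supported _ A' (B * e^-1)).
    + by apply: measurable_funM => //; exact: measurable_truncated_inv.
    + by move=> x xA; rewrite sg// mul0r.
    + by move=> x; rewrite normrM ler_pM// truncated_inv_le.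
  - apply: (@integrable_supported _ A' (B * L^-1)).
    + by apply: measurable_funM.
    + by move=> x xA; rewrite sg// mul0r.
    + by move=> x; rewrite normrM ler_pM// near_pole_le.
apply: cvgB; first exact: (truncated_inv_limit mg sg gB K0 gK).
apply/cvgr0Pnorm_lt => d d0; near=> e.
have e0 : 0 < e by near: e; exact: nbhs_right_gt.
have eL : e < L by near: e; exact: nbhs_right_lt.
(* For [e < L] the other pole is at distance at least [L], so the correction is at most [1 / L], on
   a ball of length [2 * e]. *)
apply: (@le_lt_trans _ _ (2 * e * (B * L^-1))).
  apply: normr_Rintegral_le; first exact: ltW.
  - by apply: measurable_funM.
  - by move=> x ex; rewrite /q ltNge (ltW ex)/= mulr0n mul0r mulr0.
  - by move=> x; rewrite normrM ler_pM// near_pole_le.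
apply: (@le_lt_trans _ _ (e * (2 * (B * L^-1) + 1))).
  by rewrite mulrDr mulr1 (mulrC 2) -mulrA lerDl ltW.
rewrite -ltr_pdivlMr; last first.
  by rewrite ltr_wpDl// !mulr_ge0// invr_ge0 ltW.
near: e; apply: nbhs_right_lt; rewrite divr_gt0// ltr_wpDl// !mulr_ge0//.
by rewrite invr_ge0 ltW.
Unshelve. all: by end_near. Qed.

(** An exact identity for each positive radius: off the balls it is the partial fraction
    decomposition, and on them both integrands vanish. *)
Lemma pv_reg_poles (f : R -> R) e : 0 < e ->
  (forall x, f x = C x / (L ^+ 2 - (x - s) ^+ 2)) ->
  pv_reg (- A) A [:: s - L; s + L] f e =
  (2 * L)^-1 * (\int[mu]_x (g1 x * k' e x) + \int[mu]_x (g2 x * k' e x)).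
Proof.
move=> e0 fE; have B0 : 0 <= B by exact: le_trans (CB 0).
rewrite -(Rintegral_two_poles (mk' e) (k'_le e0)).
rewrite -RintegralZl//; last first.
  apply: (@integrable_supported _ A (B * (e^-1 + e^-1 + (e^-1 + e^-1)))).
  - apply: measurable_funM => //; apply: measurable_funD.
      apply: (measurableT_comp (mk' e)); apply: measurable_funB.
        exact: measurable_cst.
      by apply: measurable_funB; [exact: measurable_id|exact: measurable_cst].
    apply: (measurableT_comp (mk' e)); apply: measurable_funD.
      exact: measurable_cst.
    by apply: measurable_funB; [exact: measurable_id|exact: measurable_cst].
  - by move=> x xA; rewrite sC// mul0r.
  - move=> x; rewrite normrM ler_pM// (le_trans (ler_normD _ _))//.
    by rewrite lerD// k'_le.
rewrite /pv_reg Rintegral_mkcond; apply: eq_Rintegral => x _.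
rewrite patchE; case: ifPn => [|/negP].
  rewrite inE => -[/= xA xp].
  have p1 : e <= `|x - (s - L)| by apply: xp; rewrite inE eqxx.
  have p2 : e <= `|x - (s + L)| by apply: xp; rewrite !inE eqxx orbT.
  have a1 : L + (x - s) = x - (s - L) by ring.
  have a2 : L - (x - s) = - (x - (s + L)) by ring.
  rewrite fE /k' a1 a2 /truncated_inv normrN p1 p2 !ltNge p1 p2/= !mulr0n !mulr1n.
  rewrite !mul0r !subr0 !mul1r.
  have n1 : x - (s - L) != 0 by rewrite -normr_gt0 (lt_le_trans e0).
  have n2 : x - (s + L) != 0 by rewrite -normr_gt0 (lt_le_trans e0).
  have -> : L ^+ 2 - (x - s) ^+ 2 = - ((x - (s - L)) * (x - (s + L))) by ring.
  have nL : 2 * L != 0 by rewrite gt_eqF// mulr_gt0.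
  move: n1 n2 nL; have -> : 2 * L = x - (s - L) - (x - (s + L)) by ring.
  move: (x - (s - L)) (x - (s + L)) => u v n1 n2 nuv.
  by field; rewrite n1 n2 nuv.
rewrite inE/= => h.
have [xA|] := leP `|x| A; last by move=> /sC ->; rewrite mul0r mulr0.
suff -> : k' e (L - (x - s)) + k' e (L + (x - s)) = 0 by rewrite !mulr0.
have : `|L + (x - s)| < e \/ `|L - (x - s)| < e.
  apply: contrapT => /not_orP[/negP]; rewrite -leNgt => h1 /negP; rewrite -leNgt => h2.
  apply: h; split; first by rewrite in_itv/= -ler_norml.
  move=> p; rewrite !inE => /orP[] /eqP ->.
    by have -> : x - (s - L) = L + (x - s) by ring.
  have -> : x - (s + L) = - (L - (x - s)) by ring.
  by rewrite normrN.
have r1 : 2 * L - (L - (x - s)) = L + (x - s) by ring.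
have r2 : 2 * L - (L + (x - s)) = L - (x - s) by ring.
rewrite /k' r1 r2; set u := L + (x - s); set v := L - (x - s).
rewrite /truncated_inv => -[] h1.
  rewrite h1 (leNgt e `|u|) h1/= !mulr0n !mul0r !mulr0 !mulr1n mul1r.
  by rewrite subr0 sub0r subrr.
rewrite h1 (leNgt e `|v|) h1/= !mulr0n !mul0r !mulr0 !mulr1n mul1r.
by rewrite subr0 sub0r addrC subrr.
Qed.

Lemma pv_reg_limit (f : R -> R) : (forall x, f x = C x / (L ^+ 2 - (x - s) ^+ 2)) ->
  pv_reg (- A) A [:: s - L; s + L] f e @[e --> 0^'+] --> (2 * L)^-1 * pole_pv.
Proof.
move=> fE.
apply: (@cvg_trans _ ((fun e => (2 * L)^-1 *
    (\int[mu]_x (g1 x * k' e x) + \int[mu]_x (g2 x * k' e x))) @ 0^'+)).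
  apply: near_eq_cvg; near=> e; rewrite pv_reg_poles//.
apply: cvgM; first exact: cvg_cst.
apply: cvgD.
- exact: (k'_limit mg1 sg1 (fun x => CB _) g1K).
- exact: (k'_limit mg2 sg2 (fun x => CB _) g2K).
Unshelve. all: by end_near. Qed.

End PoleLimits.

(** * Regularized propagators *)

Section ComplexKernels.
Context {R : realType}.
Implicit Types (u e L : R).

Lemma cvg_complex (T : Type) (F : set_system T) (f g : T -> R) (a b : R) :
  Filter F -> f x @[x --> F] --> a -> g x @[x --> F] --> b ->
  ((f x +i* g x : R[i]^o) @[x --> F]) --> (a +i* b : R[i]^o).
Proof.
move=> FF fa gb; apply/cvgrPdist_lt => e e0.
(* The radius is a complex number; being positive in the partial order, it is real. *)
have [er e0r] : e = (complex.Re e)%:C /\ 0 < complex.Re e.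
  move: e0; rewrite ltcE => /andP[/eqP i0 r0]; split=> //.
  by apply/eqP; rewrite eq_complex/= eqxx/= i0.
have e20 : 0 < complex.Re e / 2 by rewrite divr_gt0.
near=> x.
rewrite er -[X in `|X|]/((a - f x) +i* (b - g x)) normc_def ltcR/=.
have h1 : `|a - f x| < complex.Re e / 2.
  by near: x; move/cvgrPdist_lt : fa; exact.
have h2 : `|b - g x| < complex.Re e / 2.
  by near: x; move/cvgrPdist_lt : gb; exact.
rewrite -(ltr_pXn2r (n := 2)) ?nnegrE ?sqrtr_ge0 ?(ltW e0r)//.
rewrite sqr_sqrtr ?addr_ge0 ?sqr_ge0//.
rewrite -(real_normK (num_real (a - f x))) -(real_normK (num_real (b - g x))).
by have := normr_ge0 (a - f x); have := normr_ge0 (b - g x); nra.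
Unshelve. all: by end_near. Qed.

Definition feynman_re L e u :=
  (8 * pi ^+ 2 * L)^-1 *
  (conj_poisson_kernel e (L - u) + conj_poisson_kernel e (L + u)).

(** Up to the prefactor, the imaginary part is the Poisson kernel at [L + |u|] minus that at
    [L - |u|]. Adding and subtracting the former removes the absolute value from the singular pair
    and confines it to a term without a pole. *)
Definition feynman_im L e u :=
  (8 * pi ^+ 2 * L)^-1 *
  (2 * poisson_kernel e (L + `|u|) -
   (poisson_kernel e (L - u) + poisson_kernel e (L + u))).

Lemma pi2_neq0 : (pi : R) ^+ 2 != 0.
Proof. by rewrite expf_neq0// gt_eqF// pi_gt0. Qed.

Lemma feynmanE L e u : 0 < L -> 0 < e ->
  feynman L e u = feynman_re L e u +i* feynman_im L e u.
Proof.
move=> L0 e0; rewrite /feynman.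
(* The denominator is [a * b] and [a + b = 2 * L], so its inverse is [(a^-1 + b^-1) / (a + b)]. *)
pose a : R[i] := (L - `|u|) +i* e; pose b : R[i] := (L + `|u|) -i* e.
have en : e != 0 by rewrite gt_eqF.
have an : a != 0 by rewrite eq_complex/= negb_and en orbT.
have bn : b != 0 by rewrite eq_complex/= negb_and oppr_eq0 en orbT.
have cn : (4 * pi ^+ 2)%:C != 0 :> R[i].
  by rewrite eq_complex/= eqxx andbT mulf_neq0// pi2_neq0.
have abE : a + b = (2 * L)%:C.
  by apply/eqP; rewrite eq_complex/=; apply/andP; split; apply/eqP; ring.
have abn : a + b != 0.
  by rewrite abE eq_complex/= eqxx andbT mulf_neq0// gt_eqF.
have -> : (L ^+ 2)%:C - (`|u| -i* e) ^+ 2 = a * b.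
  by apply/eqP; rewrite expr2 eq_complex/=; apply/andP; split; apply/eqP; ring.
have -> : 1 / ((4 * pi ^+ 2)%:C * (a * b)) =
    ((4 * pi ^+ 2)%:C * (a + b))^-1 * (a^-1 + b^-1).
  by move: an bn cn abn; move: (_%:C) => c an bn cn abn; field; rewrite an bn cn abn.
have -> : (4 * pi ^+ 2)%:C * (a + b) = (8 * pi ^+ 2 * L)%:C :> R[i].
  by rewrite abE -rmorphM/=; congr (_%:C); ring.
rewrite -fmorphV/=.
have -> : a^-1 = conj_poisson_kernel e (L - `|u|) -i* poisson_kernel e (L - `|u|).
  by [].
have -> : b^-1 = conj_poisson_kernel e (L + `|u|) +i* poisson_kernel e (L + `|u|).
  rewrite /GRing.inv/= /conj_poisson_kernel /poisson_kernel sqrrN.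
  by congr (_ +i* _); rewrite mulNr opprK.
rewrite /feynman_re /feynman_im; apply/eqP; rewrite eq_complex/=.
apply/andP; split; apply/eqP.
  by case: (ger0P u) => _; rewrite ?opprK; ring.
by case: (ger0P u) => _; rewrite ?opprK; ring.
Qed.

Definition wightman_re e u := - (4 * pi ^+ 2)^-1 * finite_part_kernel e u.

(** The imaginary part of [1 / (u - i e)^2]. *)
Definition odd_finite_part_kernel e u := 2 * e * u / (u ^+ 2 + e ^+ 2) ^+ 2.

Definition wightman_im e u := - (4 * pi ^+ 2)^-1 * odd_finite_part_kernel e u.

Lemma wightmanE e u : 0 < e ->
  wightman_coincident e u = wightman_re e u +i* wightman_im e u.
Proof.
move=> e0; rewrite /wightman_coincident.
have S0 : u ^+ 2 + e ^+ 2 != 0 by rewrite gt_eqF// sqrD_gt0.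
have en : e != 0 by rewrite gt_eqF.
have cn : (4 * pi ^+ 2)%:C != 0 :> R[i].
  by rewrite eq_complex/= eqxx andbT mulf_neq0// pi2_neq0.
pose z : R[i] := u -i* e.
have zn : z != 0 by rewrite eq_complex/= negb_and oppr_eq0 en orbT.
have zV : (z ^+ 2)^-1 =
    finite_part_kernel e u +i* odd_finite_part_kernel e u.
  apply: (mulfI (expf_neq0 2 zn)); rewrite divff ?expf_neq0//.
  apply/eqP; rewrite expr2 eq_complex/= /finite_part_kernel /odd_finite_part_kernel.
  by apply/andP; split; apply/eqP; field.
rewrite -[u -i* e]/z invfM mulrA zV mulN1r -fmorphV/=.
by apply/eqP; rewrite eq_complex/=; apply/andP; split; apply/eqP;
  rewrite /wightman_re /wightman_im; ring.
Qed.

Lemma complex_phase_mul (c y p q : R) :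
  c%:C * expi y * (p +i* q) =
  (c * (cos y * p - sin y * q)) +i* (c * (cos y * q + sin y * p)).
Proof.
by apply/eqP; rewrite eq_complex/=; apply/andP; split; apply/eqP; ring.
Qed.

End ComplexKernels.

(** * Field coefficients *)

Section Trigonometry.
Context {R : realType}.

Lemma normr_sin_le (x : R) : `|sin x| <= `|x|.
Proof.
have le_sin (y : R) : 0 <= y -> `|sin y| <= `|y|.
  move=> y0; have [|z _] := @MVT_segment R sin cos 0 y y0 (fun z _ => is_derive_sin z).
    by apply: continuous_subspaceT; exact: continuous_sin.
  rewrite sin0 !subr0 => ->; rewrite normrM -[leRHS]mul1r ler_wpM2r//.
  exact: cos_max.
have [|/ltW x0] := leP 0 x; first exact: le_sin.
by rewrite -(normrN (sin x)) -sinN -(normrN x) le_sin// oppr_ge0.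
Qed.

Lemma normr_cosB1_le (x : R) : `|cos x - 1| <= x ^+ 2.
Proof.
have le_cos (y : R) : 0 <= y -> `|cos y - 1| <= y ^+ 2.
  move=> y0; have [|z zy] := @MVT_segment R cos (fun z => - sin z) 0 y y0
    (fun z _ => is_derive_cos z).
    by apply: continuous_subspaceT; exact: continuous_cos.
  rewrite cos0 subr0 => ->; rewrite normrM normrN (ger0_norm y0) expr2.
  rewrite ler_wpM2r// (le_trans (normr_sin_le z))//.
  by move: zy; rewrite in_itv/= => /andP[z0 zy]; rewrite ger0_norm.
have [|/ltW x0] := leP 0 x; first exact: le_cos.
by rewrite -cosN -sqrrN le_cos// oppr_ge0.
Qed.

(** By the mean value theorem, with [|cos z - 1|] at most [z^2] for [z <= 1] and at most 2
    otherwise. The constant is crude, but any quadratic bound makes [sin (Omega * x) / x] Lipschitz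
    at 0. *)
Lemma normr_sinB_le (x : R) : `|sin x - x| <= 2 * x ^+ 2.
Proof.
have le_sin (y : R) : 0 <= y -> `|sin y - y| <= 2 * y ^+ 2.
  move=> y0; have dsin (z : R) : z \in `]0, y[ ->
      is_derive z (1 : R) (fun z : R => sin z - z) (cos z - 1).
    by move=> _; apply: is_deriveB.
  have [|z zy] := @MVT_segment R (fun z => sin z - z) (fun z => cos z - 1) 0 y y0 dsin.
  - apply: continuous_subspaceT => u; apply: cvgB; [exact: continuous_sin|exact: cvg_id].
  rewrite sin0 !subr0 => ->.
  have : `|cos z - 1| <= 2 * y.
    have z0 : 0 <= z by move: zy; rewrite in_itv/= => /andP[].
    have zy' : z <= y by move: zy; rewrite in_itv/= => /andP[].
    have [z1|z1] := leP z 1.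
      by rewrite (le_trans (normr_cosB1_le z))//; nra.
    by rewrite (le_trans (ler_normB _ _))// normr1; have := cos_max z; lra.
  by rewrite normrM (ger0_norm y0) expr2 mulrA => h; rewrite ler_wpM2r.
have [|/ltW x0] := leP 0 x; first exact: le_sin.
rewrite -(normrN (sin x - x)) opprD -sinN -(sqrrN x).
by apply: le_sin; rewrite oppr_ge0.
Qed.

End Trigonometry.

(** * Regularized coefficients as one-dimensional integrals *)

Section FieldCoefficients.
Context {R : realType}.
Notation mu := (@lebesgue_measure R).
Notation mu2 := (mu \x mu)%E.
Variables (T K B : R) (chi : R -> R).
Hypotheses (T0 : 0 < T) (K0 : 0 <= K).
Hypothesis chi_lip : forall x y, `|chi x - chi y| <= K * `|x - y|.
Hypothesis chiB : forall x, `|chi x| <= B.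
Hypothesis sc : supported_in T chi.
Hypothesis chi_even : forall t, chi (- t) = chi t.
Variable Omega : R.

Let B0 : 0 <= B. Proof. exact: le_trans (chiB 0). Qed.

Let T20 : 0 < 2 * T. Proof. by rewrite mulr_gt0. Qed.

Lemma measurable_cos_affine (a b : R) :
  measurable_fun setT (fun z : R => cos (a * z + b)).
Proof.
apply: (measurableT_comp measurable_cos).
apply: measurable_funD; last exact: measurable_cst.
by apply: measurable_funM; [exact: measurable_cst|exact: measurable_id].
Qed.

Lemma measurable_sin_affine (a b : R) :
  measurable_fun setT (fun z : R => sin (a * z + b)).
Proof.
apply: (measurableT_comp measurable_sin).
apply: measurable_funD; last exact: measurable_cst.
by apply: measurable_funM; [exact: measurable_cst|exact: measurable_id].
Qed.

Lemma measurable_cos_scale (a : R) : measurable_fun setT (fun z : R => cos (a * z)).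
Proof. by have := measurable_cos_affine a 0; under eq_fun do rewrite addr0. Qed.

Lemma measurable_sin_scale (a : R) : measurable_fun setT (fun z : R => sin (a * z)).
Proof. by have := measurable_sin_affine a 0; under eq_fun do rewrite addr0. Qed.

Lemma overlapN (a : R -> R) x : overlap chi a (- x) = overlap chi a x.
Proof.
by apply: eq_Rintegral => z _; rewrite mulNr opprK [chi _ * chi _]mulrC.
Qed.

(** The reflection [z -> - z] exchanges the two factors, [chi] being even, and changes the sign of
    the sine. *)
Lemma overlap_sin x : overlap chi (fun z => sin (2 * Omega * z)) x = 0.
Proof.
apply: Rintegral_odd; first exact: (integrable_overlap chi_lip chiB sc
  (measurable_sin_scale _) (fun=> sin_max _)).
move=> z; rewrite mulrN sinN mulrN; congr (- (_ * _)).
have -> : - z + x / 2 = - (z - x / 2) by ring.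
have -> : - z - x / 2 = - (z + x / 2) by ring.
by rewrite !chi_even mulrC.
Qed.

Section Shift.
Variable s : R.

Let ic x := integrable_overlap chi_lip chiB sc
  (measurable_cos_scale (2 * Omega)) (fun=> cos_max _) x.

Let isn x := integrable_overlap chi_lip chiB sc
  (measurable_sin_scale (2 * Omega)) (fun=> sin_max _) x.

Let overlap_comb (p q x : R) :
  \int[mu]_z (p * (chi (z + x / 2) * chi (z - x / 2) * cos (2 * Omega * z)) +
             q * (chi (z + x / 2) * chi (z - x / 2) * sin (2 * Omega * z))) =
  p * C_overlap Omega chi x.
Proof.
rewrite RintegralD//.
- rewrite (RintegralZl _ _ (ic x))// (RintegralZl _ _ (isn x))//.
  by rewrite [X in _ + _ * X]overlap_sin mulr0 addr0.
- by have := integrableZl measurableT p (ic x);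
    apply: eq_integrable => // z _ /=; rewrite EFinM.
- by have := integrableZl measurableT q (isn x);
    apply: eq_integrable => // z _ /=; rewrite EFinM.
Qed.

Lemma overlap_cos_shift x : overlap chi (fun z => cos (Omega * (2 * z + s))) x =
  cos (Omega * s) * C_overlap Omega chi x.
Proof.
rewrite -(overlap_comb _ (- sin (Omega * s))); apply: eq_Rintegral => z _.
by rewrite mulrDr mulrA (mulrC Omega 2) cosD; ring.
Qed.

Lemma overlap_sin_shift x : overlap chi (fun z => sin (Omega * (2 * z + s))) x =
  sin (Omega * s) * C_overlap Omega chi x.
Proof.
rewrite -(overlap_comb _ (cos (Omega * s))); apply: eq_Rintegral => z _.
by rewrite mulrDr mulrA (mulrC Omega 2) sinD; ring.
Qed.

End Shift.

Lemma C_overlap_lip x y :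
  `|C_overlap Omega chi x - C_overlap Omega chi y| <= 2 * T * (K * B) * `|x - y|.
Proof.
exact: (overlap_lip T0 chi_lip chiB sc (measurable_cos_scale (2 * Omega))
  (fun z => cos_max (2 * Omega * z))).
Qed.

Lemma C_overlap_le x : `|C_overlap Omega chi x| <= 2 * T * (B * B).
Proof.
exact: (overlap_le T0 chi_lip chiB sc (measurable_cos_scale (2 * Omega))
  (fun z => cos_max (2 * Omega * z))).
Qed.

Lemma supported_C_overlap : supported_in (2 * T) (C_overlap Omega chi).
Proof. exact: (supported_overlap sc (fun z => cos (2 * Omega * z))). Qed.

Lemma measurable_C_overlap : measurable_fun setT (C_overlap Omega chi).
Proof.
by apply: continuous_measurable_fun; exact: lipschitz_continuous C_overlap_lip.
Qed.

Lemma Rintegral_two_time_comb (a b k l : R -> R) M s :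
  measurable_fun setT a -> (forall x, `|a x| <= 1) ->
  measurable_fun setT b -> (forall x, `|b x| <= 1) ->
  measurable_fun setT k -> (forall x, `|k x| <= M) ->
  measurable_fun setT l -> (forall x, `|l x| <= M) ->
  \int[mu2]_p (chi p.1 * chi (p.2 - s) *
    (a (p.1 + p.2) * k (p.1 - p.2) + b (p.1 + p.2) * l (p.1 - p.2))) =
  \int[mu]_x (overlap chi (fun z => a (2 * z + s)) x * k (x - s)) +
  \int[mu]_x (overlap chi (fun z => b (2 * z + s)) x * l (x - s)).
Proof.
move=> ma a1 mb b1 mk kM ml lM.
rewrite -(Rintegral_two_time chi_lip chiB sc s ma a1 mk kM).
rewrite -(Rintegral_two_time chi_lip chiB sc s mb b1 ml lM).
rewrite -RintegralD//.
- by apply: eq_Rintegral => p _; rewrite mulrDr !mulrA.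
- exact: (integrable_two_time chi_lip chiB sc s ma a1 mk kM).
- exact: (integrable_two_time chi_lip chiB sc s mb b1 ml lM).
Qed.

Section Amplitude.
Variables (L s : R).
Hypothesis L0 : 0 < L.

Lemma measurable_two_poles (k : R -> R) : measurable_fun setT k ->
  measurable_fun setT (fun u : R => k (L - u) + k (L + u)).
Proof.
move=> mk; apply: measurable_funD; apply: (measurableT_comp mk).
  by apply: measurable_funB; [exact: measurable_cst|exact: measurable_id].
by apply: measurable_funD; [exact: measurable_cst|exact: measurable_id].
Qed.

Lemma measurable_feynman_re e : 0 < e -> measurable_fun setT (feynman_re L e).
Proof.
move=> e0; apply: measurable_funM; first exact: measurable_cst.
exact: (measurable_two_poles (measurable_conj_poisson_kernel e0)).
Qed.

Lemma measurable_feynman_im e : 0 < e -> measurable_fun setT (feynman_im L e).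
Proof.
move=> e0; have mp := continuous_measurable_fun (continuous_poisson_kernel e0).
apply: measurable_funM; first exact: measurable_cst.
apply: measurable_funB.
  apply: measurable_funM; first exact: measurable_cst.
  apply: (measurableT_comp mp); apply: measurable_funD; first exact: measurable_cst.
  exact: normr_measurable.
exact: (measurable_two_poles mp).
Qed.

Let c := (8 * pi ^+ 2 * L)^-1.

Let c0 : 0 <= c.
Proof. by rewrite invr_ge0 mulr_ge0 ?(ltW L0)// mulr_ge0 ?sqr_ge0. Qed.

Lemma feynman_re_le e : 0 < e -> forall u, `|feynman_re L e u| <= c * (4 * e^-1).
Proof.
move=> e0 u; rewrite normrM (ger0_norm c0) ler_wpM2l//.
apply: le_trans (ler_normD _ _) _.
have h1 := conj_poisson_kernel_le (L - u) e0.
have h2 := conj_poisson_kernel_le (L + u) e0.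
have : 0 <= e^-1 by rewrite invr_ge0 ltW.
lra.
Qed.

Lemma feynman_im_le e : 0 < e -> forall u, `|feynman_im L e u| <= c * (4 * e^-1).
Proof.
move=> e0 u; rewrite normrM (ger0_norm c0) ler_wpM2l//.
have h1 := poisson_kernel_le (L - u) e0.
have h2 := poisson_kernel_le (L + u) e0.
have h3 := poisson_kernel_le (L + `|u|) e0.
have p1 := poisson_kernel_ge0 (L - u) e0.
have p2 := poisson_kernel_ge0 (L + u) e0.
have p3 := poisson_kernel_ge0 (L + `|u|) e0.
by rewrite ler_norml; lra.
Qed.

Let C := C_overlap Omega chi.

Definition hadamard_reg e := \int[mu]_x (C x * feynman_re L e (x - s)).
Definition quadrature_reg e := \int[mu]_x (C x * feynman_im L e (x - s)).

Lemma integrable_C_kernel (k : R -> R) M : measurable_fun setT k ->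
  (forall x, `|k x| <= M) -> mu.-integrable setT (EFin \o (fun x => C x * k (x - s))).
Proof.
move=> mk kM; apply: (@integrable_supported _ (2 * T) (2 * T * (B * B) * M)).
- apply: measurable_funM; first exact: measurable_C_overlap.
  apply: (measurableT_comp mk).
  by apply: measurable_funB; [exact: measurable_id|exact: measurable_cst].
- by move=> x xT; rewrite /C supported_C_overlap// mul0r.
- by move=> x; rewrite normrM ler_pM// C_overlap_le.
Qed.

(** The phase is [expi (Omega * (2 * z + s))] in the new variables. Since the sine overlap vanishes,
    [expi (Omega * s)] factors out already at fixed [e] and leaves the real function [C], so the
    real and imaginary parts of the propagator do not mix. *)
Lemma M_reg_overlap e : 0 < e -> M_reg L Omega s chi e =
  - (expi (Omega * s) * (hadamard_reg e +i* quadrature_reg e)) :> R[i].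
Proof.
move=> e0.
have mr := measurable_feynman_re e0; have rM := feynman_re_le e0.
have mi := measurable_feynman_im e0; have iM := feynman_im_le e0.
have mc := measurable_cos_scale Omega; have ms := measurable_sin_scale Omega.
have mNs : measurable_fun setT (fun z : R => - sin (Omega * z)).
  by under eq_fun do rewrite -mulN1r; apply: measurable_funM => //; exact: measurable_cst.
have c1 (x : R) : `|cos (Omega * x)| <= 1 by exact: cos_max.
have s1 (x : R) : `|sin (Omega * x)| <= 1 by exact: sin_max.
have Ns1 (x : R) : `|- sin (Omega * x)| <= 1 by rewrite normrN sin_max.
have pull (p : R) (k : R -> R) M : measurable_fun setT k -> (forall x, `|k x| <= M) ->
    forall f : R -> R, (forall x, f x = p * C x) ->
    \int[mu]_x (f x * k (x - s)) = p * \int[mu]_x (C x * k (x - s)).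
  move=> mk kM f fE; rewrite -RintegralZl//; last exact: (integrable_C_kernel mk kM).
  by apply: eq_Rintegral => x _; rewrite fE mulrA.
have oNs x : overlap chi (fun z => - sin (Omega * (2 * z + s))) x =
    - sin (Omega * s) * C x.
  rewrite mulNr -overlap_sin_shift -mulN1r -RintegralZl//.
    by apply: eq_Rintegral => z _; rewrite mulrN mulN1r.
  apply: (integrable_overlap chi_lip chiB sc) => [|z]; last exact: sin_max.
  apply: (measurableT_comp ms); apply: measurable_funD; last exact: measurable_cst.
  by apply: measurable_funM; [exact: measurable_cst|exact: measurable_id].
rewrite /M_reg; congr (- _); rewrite /cintegral2.
have -> : expi (Omega * s) * (hadamard_reg e +i* quadrature_reg e) =
  (cos (Omega * s) * hadamard_reg e + - sin (Omega * s) * quadrature_reg e) +i*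
  (cos (Omega * s) * quadrature_reg e + sin (Omega * s) * hadamard_reg e).
  by apply/eqP; rewrite eq_complex/=; apply/andP; split; apply/eqP; ring.
congr (_ +i* _).
- rewrite /hadamard_reg /quadrature_reg.
  rewrite -(pull _ _ _ mr rM _ (overlap_cos_shift s)) -(pull _ _ _ mi iM _ oNs).
  rewrite -(Rintegral_two_time_comb s mc c1 mNs Ns1 mr rM mi iM).
  apply: eq_Rintegral => p _.
  by rewrite feynmanE// complex_phase_mul/= mulNr.
- rewrite /hadamard_reg /quadrature_reg.
  rewrite -(pull _ _ _ mi iM _ (overlap_cos_shift s)).
  rewrite -(pull _ _ _ mr rM _ (overlap_sin_shift s)).
  rewrite -(Rintegral_two_time_comb s mc c1 ms s1 mi iM mr rM).
  apply: eq_Rintegral => p _.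
  by rewrite feynmanE// complex_phase_mul/=.
Qed.

Lemma hadamard_limit :
  hadamard_reg e @[e --> 0^'+] --> c * pole_pv (2 * T) L s C.
Proof.
have KB0 : 0 <= 2 * T * (K * B) by rewrite !mulr_ge0// ltW.
apply: (@cvg_trans _ ((fun e => c * \int[mu]_x (C x *
    (conj_poisson_kernel e (L - (x - s)) + conj_poisson_kernel e (L + (x - s)))))
    @ 0^'+)).
  apply: near_eq_cvg; near=> e.
  have e0 : 0 < e by near: e; exact: nbhs_right_gt.
  rewrite -RintegralZl//.
    by apply: eq_Rintegral => x _; rewrite /feynman_re -/c mulrCA.
  apply: (@integrable_C_kernel (fun u => conj_poisson_kernel e (L - u) +
    conj_poisson_kernel e (L + u)) (e^-1 + e^-1)).
    exact: (measurable_two_poles (measurable_conj_poisson_kernel e0)).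
  move=> x; rewrite (le_trans (ler_normD _ _))//.
  by rewrite lerD// conj_poisson_kernel_le.
apply: cvgM; first exact: cvg_cst.
exact: (two_pole_conj_poisson_limit KB0 L0 C_overlap_lip C_overlap_le
  supported_C_overlap).
Unshelve. all: by end_near. Qed.

Lemma quadrature_limit :
  quadrature_reg e @[e --> 0^'+] -->
  - ((C (s - L) + C (s + L)) / (8 * pi * L)).
Proof.
have KB0 : 0 <= 2 * T * (K * B) by rewrite !mulr_ge0// ltW.
have pin : (pi : R) != 0 by rewrite gt_eqF// pi_gt0.
(* The 0 is the limit of the term without a pole; [pi] is the mass of the Poisson kernel and cancels
   one factor of [8 * pi^2 * L]. *)
have -> : - ((C (s - L) + C (s + L)) / (8 * pi * L)) =
    c * (2 * 0 - pi * (C (s + L) + C (s - L))).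
  have Ln : L != 0 by rewrite gt_eqF.
  rewrite /c; move: (pi) pin => p pin; field.
  by rewrite pin Ln.
apply: (@cvg_trans _ ((fun e => c * (
    2 * \int[mu]_x (C x * poisson_kernel e (L + `|x - s|)) -
    \int[mu]_x (C x * (poisson_kernel e (L - (x - s)) + poisson_kernel e (L + (x - s))))))
    @ 0^'+)).
  apply: near_eq_cvg; near=> e.
  have e0 : 0 < e by near: e; exact: nbhs_right_gt.
  have mp := continuous_measurable_fun (continuous_poisson_kernel e0).
  have i1 : mu.-integrable setT (EFin \o (fun x => C x * poisson_kernel e (L + `|x - s|))).
    apply: (@integrable_C_kernel (fun u => poisson_kernel e (L + `|u|)) e^-1).
      apply: (measurableT_comp mp); apply: measurable_funD; first exact: measurable_cst.
      exact: normr_measurable.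
    by move=> x; rewrite ger0_norm ?poisson_kernel_le// poisson_kernel_ge0.
  have i2 : mu.-integrable setT (EFin \o (fun x => C x *
      (poisson_kernel e (L - (x - s)) + poisson_kernel e (L + (x - s))))).
    apply: (@integrable_C_kernel (fun u => poisson_kernel e (L - u) +
      poisson_kernel e (L + u)) (e^-1 + e^-1)).
      exact: (measurable_two_poles mp).
    move=> x; rewrite (le_trans (ler_normD _ _))//.
    by rewrite lerD// ger0_norm ?poisson_kernel_le// poisson_kernel_ge0.
  have i3 : mu.-integrable setT (EFin \o (fun x => 2 * (C x * poisson_kernel e (L + `|x - s|)))).
    by have := integrableZl measurableT 2 i1;
      apply: eq_integrable => // z _ /=; rewrite EFinM.
  rewrite -RintegralZl// -RintegralB// -RintegralZl//.
    by apply: eq_Rintegral => x _; rewrite /feynman_im -/c; ring.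
  by have := integrableB measurableT i3 i2; apply: eq_integrable => // z _ /=.
apply: cvgM; first exact: cvg_cst.
apply: cvgB.
  apply: cvgM; first exact: cvg_cst.
  exact: (regular_poisson_limit s L0 C_overlap_lip C_overlap_le supported_C_overlap).
exact: (two_pole_poisson_limit T20 KB0 L0 C_overlap_lip C_overlap_le supported_C_overlap).
Unshelve. all: by end_near. Qed.

End Amplitude.

Let D := overlap chi (fun=> 1).

Let m1 : measurable_fun setT (fun _ : R => 1 : R).
Proof. exact: measurable_cst. Qed.

Let n1 : R -> `|1 : R| <= 1. Proof. by rewrite normr1. Qed.

Let DB x : `|D x| <= 2 * T * (B * B).
Proof. exact: (overlap_le T0 chi_lip chiB sc m1 n1). Qed.

Let Dlip x y : `|D x - D y| <= 2 * T * (K * B) * `|x - y|.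
Proof. exact: (overlap_lip T0 chi_lip chiB sc m1 n1). Qed.

Let Dquad x := overlap1_quadratic T0 K0 chi_lip chiB sc x.

Let mD : measurable_fun setT D.
Proof. by apply: continuous_measurable_fun; exact: lipschitz_continuous Dlip. Qed.

Let sD : supported_in (2 * T) D.
Proof. exact: (supported_overlap sc (fun=> 1)). Qed.

Let BD := 2 * T * (B * B).

Let BD0 : 0 <= BD. Proof. exact: le_trans (DB 0). Qed.

Let Kq := 2 * T * (K * K) + B * B / (2 * T).

Let Kq0 : 0 <= Kq.
Proof.
by rewrite addr_ge0//; [rewrite !mulr_ge0// ltW|rewrite divr_ge0// ?mulr_ge0// ltW].
Qed.

Lemma finite_part_overlap_cvg :
  cvg (\int[mu]_x (D x * cos (Omega * x) * finite_part_kernel e x) @[e --> 0^'+]).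
Proof.
apply: (@finite_part_limit _ (fun x => D x * cos (Omega * x)) (2 * T) (BD * 1)
  (Kq + BD * Omega ^+ 2)) => //.
- by apply: measurable_funM => //; exact: measurable_cos_scale.
- by move=> x xT; rewrite sD// mul0r.
- by move=> x; rewrite normrM ler_pM// ?DB// cos_max.
- by rewrite addr_ge0// mulr_ge0// sqr_ge0.
move=> x; rewrite mulr0 cos0 mulr1.
(* Both differences are quadratic in [x]: that of [D] by polarization, that of the cosine by its
   vanishing slope at 0. *)
have -> : D x * cos (Omega * x) - D 0 =
  (D x - D 0) * cos (Omega * x) + D 0 * (cos (Omega * x) - 1) by ring.
rewrite (le_trans (ler_normD _ _))// !normrM mulrDl lerD//.
  by rewrite -[leRHS]mulr1 ler_pM// ?Dquad// cos_max.
by rewrite -mulrA -exprMn ler_pM ?DB// normr_cosB1_le.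
Qed.

(* D(x) sin(Omega x) / x with its continuous value at 0: division by 0 yields 0,
   and [box 0] is the indicator of the origin. *)
Let m x := D x * (sin (Omega * x) / x + Omega * box 0 x).

Let box0_neq0 (x : R) : x != 0 -> box 0 x = 0.
Proof. by move=> x0; rewrite /box normr_le0 (negbTE x0). Qed.

Let mE x : x != 0 -> m x = D x * (sin (Omega * x) / x).
Proof. by move=> x0; rewrite /m box0_neq0// mulr0 addr0. Qed.

Let m0E : m 0 = D 0 * Omega.
Proof. by rewrite /m invr0 mulr0 add0r /box normr0 lexx mulr1n mulr1. Qed.

Let sinc_le x : x != 0 -> `|sin (Omega * x) / x| <= `|Omega|.
Proof.
move=> x0; rewrite normrM normfV ler_pdivrMr ?normr_gt0// -normrM.
exact: normr_sin_le.
Qed.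

(** The sine supplies the factor [x] that the kernel lacks: moving it over turns the kernel into
    [square_poisson_kernel], of mass [pi], and leaves the function [m], which is bounded and
    Lipschitz at 0. The limit is [pi * D 0 * Omega]. *)
Lemma odd_finite_part_overlap_cvg :
  cvg (\int[mu]_x (D x * sin (Omega * x) * odd_finite_part_kernel e x) @[e --> 0^'+]).
Proof.
apply/cvg_ex; exists (pi * m 0).
have -> : (fun e => \int[mu]_x (D x * sin (Omega * x) * odd_finite_part_kernel e x)) =
    (fun e => \int[mu]_x (m x * square_poisson_kernel e x)).
  apply/funext => e; apply: eq_Rintegral => x _.
  rewrite /odd_finite_part_kernel /square_poisson_kernel.
  have [->|x0] := eqVneq x 0.
    by rewrite !mulr0 sin0 expr0n/= !(mulr0, mul0r).
  rewrite mE//; move: ((x ^+ 2 + e ^+ 2) ^+ 2)^-1 => t.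
  by field.
apply: (@square_poisson_limit _ m (2 * T) (BD * `|Omega|)
  (2 * T * (K * B) * `|Omega| + BD * (2 * Omega ^+ 2))) => //.
- apply: measurable_funM => //; apply: measurable_funD.
    by apply: measurable_funM; [exact: measurable_sin_scale|exact: measurable_inv].
  by apply: measurable_funM; [exact: measurable_cst|exact: measurable_box].
- by move=> x xT; rewrite /m sD// mul0r.
- move=> x; have [->|x0] := eqVneq x 0; first by rewrite m0E normrM ler_pM// DB.
  by rewrite mE// normrM ler_pM// ?DB// sinc_le.
- have Om2 := sqr_ge0 Omega; have T20' := ltW T20.
  by apply: addr_ge0; do 3?[apply: mulr_ge0 => //].
move=> x; have [->|x0] := eqVneq x 0; first by rewrite subrr !normr0 mulr0.
rewrite mE// m0E.
have -> : D x * (sin (Omega * x) / x) - D 0 * Omega =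
  (D x - D 0) * (sin (Omega * x) / x) +
  D 0 * ((sin (Omega * x) - Omega * x) / x) by field.
rewrite (le_trans (ler_normD _ _))// !normrM mulrDl lerD//.
  rewrite mulrAC ler_pM//; last by rewrite -normrM sinc_le.
  by have := Dlip x 0; rewrite subr0.
rewrite -mulrA ler_pM ?DB//.
rewrite normfV ler_pdivrMr ?normr_gt0//.
apply: le_trans (normr_sinB_le _) _.
by rewrite exprMn -[x ^+ 2](real_normK (num_real x)) expr2 !mulrA.
Qed.

End FieldCoefficients.

(** * Convergence and reality of the excitation coefficient *)

Section ExcitationProbability.
Context {R : realType}.
Notation mu := (@lebesgue_measure R).
Notation mu2 := (mu \x mu)%E.

Lemma measurable_sqrD_sqrV (e : R) :
  measurable_fun setT (fun u : R => ((u ^+ 2 + e ^+ 2) ^+ 2)^-1).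
Proof.
apply: measurable_funV; apply: measurable_funX; apply: measurable_funD.
  by apply: measurable_funX; exact: measurable_id.
exact: measurable_cst.
Qed.

Lemma measurable_finite_part_kernel (e : R) :
  measurable_fun setT (finite_part_kernel e).
Proof.
apply: measurable_funM; last exact: measurable_sqrD_sqrV.
apply: measurable_funB; last exact: measurable_cst.
by apply: measurable_funX; exact: measurable_id.
Qed.

Lemma measurable_odd_finite_part_kernel (e : R) :
  measurable_fun setT (odd_finite_part_kernel e).
Proof.
apply: measurable_funM; last exact: measurable_sqrD_sqrV.
by apply: measurable_funM; [exact: measurable_cst|exact: measurable_id].
Qed.

Lemma sqrD_inv_le (e u : R) : 0 < e -> (u ^+ 2 + e ^+ 2)^-1 <= (e ^+ 2)^-1.
Proof.
by move=> e0; rewrite lef_pV2 ?posrE ?sqrD_gt0 ?exprn_gt0// lerDr sqr_ge0.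
Qed.

Lemma odd_finite_part_kernel_le (e u : R) : 0 < e ->
  `|odd_finite_part_kernel e u| <= (u ^+ 2 + e ^+ 2)^-1.
Proof.
move=> e0; have S0 := sqrD_gt0 u e0.
rewrite normrM normfV (ger0_norm (sqr_ge0 _)) ler_pdivrMr ?exprn_gt0//.
have -> : (u ^+ 2 + e ^+ 2)^-1 * (u ^+ 2 + e ^+ 2) ^+ 2 = u ^+ 2 + e ^+ 2.
  by field; rewrite gt_eqF.
rewrite normrM normrM (gtr0_norm e0) (ger0_norm (ler0n _ 2)) -mulrA (mulrC e).
exact: mul2_le_sqrD.
Qed.

Variables (T K B : R) (chi : R -> R).
Hypotheses (T0 : 0 < T) (K0 : 0 <= K).
Hypothesis chi_lip : forall x y, `|chi x - chi y| <= K * `|x - y|.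
Hypothesis chiB : forall x, `|chi x| <= B.
Hypothesis sc : supported_in T chi.
Variable Omega : R.

Let D := overlap chi (fun=> 1).

Let DB x : `|D x| <= 2 * T * (B * B).
Proof.
apply: (overlap_le T0 chi_lip chiB sc) => [|z]; first exact: measurable_cst.
by rewrite normr1.
Qed.

Let mD : measurable_fun setT D.
Proof.
apply: (measurable_overlap T0 chi_lip chiB sc) => [|z]; first exact: measurable_cst.
by rewrite normr1.
Qed.

Let sD : supported_in (2 * T) D.
Proof. exact: (supported_overlap sc (fun=> 1)). Qed.

Let integrable_DM (k : R -> R) M : measurable_fun setT k -> (forall x, `|k x| <= M) ->
  mu.-integrable setT (EFin \o (fun x => D x * k x)).
Proof.
move=> mk kM; apply: (@integrable_supported _ (2 * T) (2 * T * (B * B) * M)).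
- exact: measurable_funM.
- by move=> x xT; rewrite sD// mul0r.
- by move=> x; rewrite normrM ler_pM.
Qed.

Let two_time1 (k : R -> R) M : measurable_fun setT k -> (forall x, `|k x| <= M) ->
  \int[mu2]_p (chi p.1 * chi p.2 * k (p.1 - p.2)) = \int[mu]_x (D x * k x).
Proof.
move=> mk kM.
have m1 : measurable_fun setT (fun _ : R => 1 : R) by exact: measurable_cst.
have n1 (x : R) : `|1 : R| <= 1 by rewrite normr1.
transitivity (\int[mu]_x (D x * k (x - 0))); last first.
  by apply: eq_Rintegral => x _; rewrite subr0.
rewrite -(Rintegral_two_time chi_lip chiB sc 0 m1 n1 mk kM).
by apply: eq_Rintegral => p _; rewrite mulr1 subr0.
Qed.

Let c : R := (4 * pi ^+ 2)^-1.

Let c0 : 0 <= c. Proof. by rewrite invr_ge0 mulr_ge0 ?sqr_ge0. Qed.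

Section Mixture.
Variables (a b p q : R -> R) (M : R).
Hypotheses (ma : measurable_fun setT a) (mb : measurable_fun setT b).
Hypotheses (mp : measurable_fun setT p) (mq : measurable_fun setT q).
Hypotheses (a1 : forall x, `|a x| <= 1) (b1 : forall x, `|b x| <= 1).
Hypotheses (pM : forall x, `|p x| <= M) (qM : forall x, `|q x| <= M).

Lemma measurable_mixture : measurable_fun setT (fun u => a u * p u + b u * q u).
Proof. by apply: measurable_funD; exact: measurable_funM. Qed.

Lemma mixture_le u : `|a u * p u + b u * q u| <= M + M.
Proof.
by rewrite (le_trans (ler_normD _ _))// !normrM lerD// -[leRHS]mul1r ler_pM.
Qed.

End Mixture.

(** The value is real for each [e > 0]: reversing [u] conjugates both the phase and the regularized
    Wightman function, so the imaginary part is odd in [u], while the autocorrelation [D] is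
    even. *)
Lemma P_reg_overlap e : 0 < e -> P_reg Omega chi e =
  (- c * (\int[mu]_x (D x * cos (Omega * x) * finite_part_kernel e x) +
          \int[mu]_x (D x * sin (Omega * x) * odd_finite_part_kernel e x)))%:C :> R[i].
Proof.
move=> e0.
have mq := measurable_finite_part_kernel e.
have mt := measurable_odd_finite_part_kernel e.
have mc := measurable_cos_scale Omega; have ms := measurable_sin_scale Omega.
have c1 (x : R) : `|cos (Omega * x)| <= 1 by exact: cos_max.
have s1 (x : R) : `|sin (Omega * x)| <= 1 by exact: sin_max.
have Ns1 (x : R) : `|- sin (Omega * x)| <= 1 by rewrite normrN sin_max.
have mNs : measurable_fun setT (fun z : R => - sin (Omega * z)).
  by under eq_fun do rewrite -mulN1r; apply: measurable_funM => //; exact: measurable_cst.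
have wM (k : R -> R) : (forall u, `|k u| <= (u ^+ 2 + e ^+ 2)^-1) ->
    forall u, `|- c * k u| <= c * (e ^+ 2)^-1.
  move=> kS u; rewrite normrM normrN (ger0_norm c0) ler_wpM2l//.
  exact: le_trans (kS u) (sqrD_inv_le u e0).
have mr : measurable_fun setT (wightman_re e).
  by apply: measurable_funM => //; exact: measurable_cst.
have mi : measurable_fun setT (wightman_im e).
  by apply: measurable_funM => //; exact: measurable_cst.
have rM : forall u, `|wightman_re e u| <= c * (e ^+ 2)^-1.
  by apply: wM => u; exact: finite_part_kernel_le.
have iM : forall u, `|wightman_im e u| <= c * (e ^+ 2)^-1.
  by apply: wM => u; exact: odd_finite_part_kernel_le.
have mre := measurable_mixture mc ms mr mi.
have mim := measurable_mixture mc mNs mi mr.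
have rre := mixture_le c1 s1 rM iM.
have rim := mixture_le c1 Ns1 iM rM.
rewrite /P_reg /cintegral2; congr (_ +i* _).
- transitivity (\int[mu2]_x0 (chi x0.1 * chi x0.2 *
      (cos (Omega * (x0.1 - x0.2)) * wightman_re e (x0.1 - x0.2) +
       sin (Omega * (x0.1 - x0.2)) * wightman_im e (x0.1 - x0.2)))).
    apply: eq_Rintegral => p _.
    by rewrite wightmanE// complex_phase_mul/= cosN sinN mulNr opprK.
  rewrite (two_time1 mre rre).
  have i1 : mu.-integrable setT (EFin \o
      (fun x => D x * (cos (Omega * x) * finite_part_kernel e x))).
    apply: (@integrable_DM _ (1 * (e ^+ 2)^-1)); first exact: measurable_funM.
    move=> x; rewrite normrM ler_pM//.
    exact: le_trans (finite_part_kernel_le x e0) (sqrD_inv_le x e0).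
  have i2 : mu.-integrable setT (EFin \o
      (fun x => D x * (sin (Omega * x) * odd_finite_part_kernel e x))).
    apply: (@integrable_DM _ (1 * (e ^+ 2)^-1)); first exact: measurable_funM.
    move=> x; rewrite normrM ler_pM//.
    exact: le_trans (odd_finite_part_kernel_le x e0) (sqrD_inv_le x e0).
  have -> : \int[mu]_x (D x * cos (Omega * x) * finite_part_kernel e x) =
      \int[mu]_x (D x * (cos (Omega * x) * finite_part_kernel e x)).
    by apply: eq_Rintegral => x _; rewrite -!mulrA.
  have -> : \int[mu]_x (D x * sin (Omega * x) * odd_finite_part_kernel e x) =
      \int[mu]_x (D x * (sin (Omega * x) * odd_finite_part_kernel e x)).
    by apply: eq_Rintegral => x _; rewrite -!mulrA.
  rewrite -RintegralD// -RintegralZl//.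
    by apply: eq_Rintegral => x _; rewrite /wightman_re /wightman_im -/c; ring.
  by have := integrableD measurableT i1 i2; apply: eq_integrable => // x _ /=.
- transitivity (\int[mu2]_x0 (chi x0.1 * chi x0.2 *
      (cos (Omega * (x0.1 - x0.2)) * wightman_im e (x0.1 - x0.2) +
       - sin (Omega * (x0.1 - x0.2)) * wightman_re e (x0.1 - x0.2)))).
    apply: eq_Rintegral => p _.
    by rewrite wightmanE// complex_phase_mul/= cosN sinN mulNr.
  rewrite (two_time1 mim rim); apply: Rintegral_odd; first exact: integrable_DM mim rim.
  move=> x; rewrite /D overlapN mulrN cosN sinN.
  rewrite /wightman_re /wightman_im /finite_part_kernel /odd_finite_part_kernel.
  by rewrite sqrrN; ring.
Qed.

Lemma P_reg_cvg : exists P : R,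
  P_reg Omega chi e @[e --> (0 : R)^'+] --> (P%:C : R[i]^o).
Proof.
have /cvg_ex[p1 cp1] :=
  finite_part_overlap_cvg (Omega := Omega) T0 K0 chi_lip chiB sc.
have /cvg_ex[p2 cp2] :=
  odd_finite_part_overlap_cvg (Omega := Omega) T0 K0 chi_lip chiB sc.
exists (- c * (p1 + p2)).
apply: (@cvg_trans _ ((fun e =>
  (- c * (\int[mu]_x (D x * cos (Omega * x) * finite_part_kernel e x) +
          \int[mu]_x (D x * sin (Omega * x) * odd_finite_part_kernel e x))) +i* 0
   : R[i]^o) @ 0^'+)).
  apply: near_eq_cvg; near=> e.
  have e0 : 0 < e by near: e; exact: nbhs_right_gt.
  by rewrite (P_reg_overlap e0).
apply: cvg_complex; last exact: cvg_cst.
apply: cvgM; first exact: cvg_cst.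
exact: cvgD.
Unshelve. all: by end_near. Qed.

Lemma P_reg_lim :
  P_reg Omega chi e @[e --> (0 : R)^'+] --> ((P_exc Omega chi)%:C : R[i]^o).
Proof.
have [P cP] := P_reg_cvg.
by rewrite /P_exc (cvg_lim _ cP).
Qed.

End ExcitationProbability.

(** * Limit of the entangling amplitude and its two quadratures *)

Section EntanglingAmplitude.
Context {R : realType}.
Notation mu := (@lebesgue_measure R).
Variables (T K B : R) (chi : R -> R).
Hypotheses (T0 : 0 < T) (K0 : 0 <= K).
Hypothesis chi_lip : forall x y, `|chi x - chi y| <= K * `|x - y|.
Hypothesis chiB : forall x, `|chi x| <= B.
Hypothesis sc : supported_in T chi.
Hypothesis chi_even : forall t, chi (- t) = chi t.
Variables (Omega L s : R).
Hypothesis L0 : 0 < L.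

Let C := C_overlap Omega chi.
Let X := (8 * pi ^+ 2 * L)^-1 * pole_pv (2 * T) L s C.
Let Y := - ((C (s - L) + C (s + L)) / (8 * pi * L)).

Lemma M_reg_lim : M_reg L Omega s chi e @[e --> (0 : R)^'+] -->
  (- (expi (Omega * s) * (X +i* Y)) : R[i]^o).
Proof.
have cX := hadamard_limit (Omega := Omega) (s := s) T0 K0 chi_lip chiB sc L0.
have cY := quadrature_limit (Omega := Omega) (s := s) T0 K0 chi_lip chiB sc L0.
set h := hadamard_reg chi Omega L s in cX; set q := quadrature_reg chi Omega L s in cY.
(* The phase is multiplied out so that convergence can be checked on components. *)
have E (x y : R) : - (expi (Omega * s) * (x +i* y)) =
  (sin (Omega * s) * y - cos (Omega * s) * x) +i*
  (- (cos (Omega * s) * y) - sin (Omega * s) * x).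
  by apply/eqP; rewrite eq_complex/=; apply/andP; split; apply/eqP; ring.
rewrite E.
apply: (@cvg_trans _ ((fun e =>
  (sin (Omega * s) * q e - cos (Omega * s) * h e) +i*
  (- (cos (Omega * s) * q e) - sin (Omega * s) * h e) : R[i]^o) @ 0^'+)).
  apply: near_eq_cvg; near=> e.
  have e0 : 0 < e by near: e; exact: nbhs_right_gt.
  by rewrite (M_reg_overlap T0 chi_lip chiB sc chi_even Omega s L0 e0) E.
have cst_cvg (a : R) : a @[_ --> (0 : R)^'+] --> a by exact: cvg_cst.
apply: cvg_complex.
  by apply: cvgB; apply: cvgM.
by apply: cvgB; [apply: cvgN|]; apply: cvgM.
Unshelve. all: by end_near. Qed.

Lemma M_ampE : M_amp L Omega s chi = - (expi (Omega * s) * (X +i* Y)).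
Proof. by rewrite /M_amp (cvg_lim _ M_reg_lim). Qed.

Lemma expiN_mul (x : R) : expi (- x) * expi x = 1.
Proof.
apply/eqP; rewrite eq_complex/= cosN sinN; apply/andP; split; apply/eqP; last by ring.
by rewrite mulNr opprK -!expr2 cos2Dsin2.
Qed.

Lemma calibrated_amp :
  - expi (- (Omega * s)) * M_amp L Omega s chi = X +i* Y.
Proof. by rewrite M_ampE mulrNN mulrA expiN_mul mul1r. Qed.

Lemma cvg_pv_overlap (f : R -> R) :
  (forall x, f x = C x / (L ^+ 2 - (x - s) ^+ 2)) ->
  pv_reg (- (2 * T)) (2 * T) [:: s - L; s + L] f e @[e --> 0^'+] -->
    (2 * L)^-1 * pole_pv (2 * T) L s C.
Proof.
have KB0 : 0 <= 2 * T * (K * B).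
  by rewrite mulr_ge0 ?mulr_ge0 ?(ltW T0)// (le_trans _ (chiB 0)).
exact: (pv_reg_limit KB0 L0 (C_overlap_lip T0 chi_lip chiB sc Omega)
  (C_overlap_le T0 chi_lip chiB sc Omega) (supported_C_overlap sc Omega)).
Qed.

(** The i-epsilon limit and the principal value are multiples of the same [pole_pv], with factors
    [(8 * pi^2 * L)^-1] and [(2 * L)^-1]; their quotient is [(4 * pi^2)^-1]. *)
Lemma hadamard_PV (f : R -> R) :
  (forall x, f x = C x / (L ^+ 2 - (x - s) ^+ 2)) ->
  X = 1 / (4 * pi ^+ 2) * PV (- (2 * T)) (2 * T) [:: s - L; s + L] f.
Proof.
move=> fE; rewrite /PV (cvg_lim _ (cvg_pv_overlap fE))//.
have Ln : L != 0 by rewrite gt_eqF.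
rewrite /X; move: (pole_pv _ _ _ _) => V.
have pn := @pi2_neq0 R; move: (pi ^+ 2) pn => p pn.
by field; rewrite pn Ln.
Qed.

End EntanglingAmplitude.

(** * The game *)

Section Game.
Context {R : realType}.
Local Notation C := R[i].

Lemma sum_prod2 (V : nmodType) (F : 'I_(2 * 2) -> V) :
  \sum_i F i = \sum_(a < 2) \sum_(b < 2) F (mxtens_index (a, b)).
Proof.
rewrite pair_big/= (reindex (@mxtens_index 2 2))/=.
  by apply: eq_bigr => -[a b].
by exists (@mxtens_unindex 2 2) => i _; [exact: mxtens_indexK|exact: mxtens_unindexK].
Qed.

Lemma bell_ketE (a b : 'I_2) :
  bell_ket R (mxtens_index (a, b)) 0 = ((Num.sqrt 2)^-1)%:C * (a == b)%:R.
Proof.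
rewrite /bell_ket mxE; congr (_ * _); rewrite mxE.
have -> : (0 : 'I_(1 * 1)) = mxtens_index ((0, 0) : 'I_1 * 'I_1) by apply/val_inj.
rewrite !tensmxE /ket_g /ket_e !mxE !eqxx !andbT.
by case: a => -[|[|//]] ia; case: b => -[|[|//]] ib;
  rewrite -!val_eqE/= ?(mulr0, mul0r, mulr1, addr0, add0r).
Qed.

Lemma Phi_plusE (a b a' b' : 'I_2) :
  Phi_plus R (mxtens_index (a, b)) (mxtens_index (a', b')) =
  2^-1 * ((a == b)%:R * (a' == b')%:R).
Proof.
rewrite /Phi_plus mxE big_ord1 bell_ketE 2!mxE bell_ketE rmorphM rmorph_nat/=.
rewrite (_ : Num.conj _ = ((Num.sqrt 2)^-1)%:C); last first.
  by apply/conj_Creal; rewrite complex_real.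
rewrite mulrACA -rmorphM/= -invfM -expr2 sqr_sqrtr ?ler0n// fmorphV/=.
by rewrite rmorph_nat.
Qed.

Lemma sum_delta (V : pzSemiRingType) n (a : 'I_n) (F : 'I_n -> V) :
  \sum_b (a == b)%:R * F b = F a.
Proof.
rewrite (bigD1 a)//= eqxx mul1r big1 ?addr0// => b ba.
by rewrite eq_sym (negbTE ba) mul0r.
Qed.

Lemma sum_prod4 (V : nmodType) (F : 'I_(2 * 2 * (2 * 2)) -> V) :
  \sum_i F i = \sum_(a < 2) \sum_(b < 2) \sum_(c < 2) \sum_(d < 2)
    F (mxtens_index (mxtens_index (a, b), mxtens_index (c, d))).
Proof.
transitivity (\sum_(u : 'I_(2 * 2)) \sum_(v : 'I_(2 * 2)) F (mxtens_index (u, v))).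
  rewrite pair_big/= (reindex (@mxtens_index (2 * 2) (2 * 2)))/=.
    by apply: eq_bigr => -[a b].
  by exists (@mxtens_unindex (2 * 2) (2 * 2)) => i _;
    [exact: mxtens_indexK|exact: mxtens_unindexK].
rewrite sum_prod2; apply: eq_bigr => a _; apply: eq_bigr => b _.
by rewrite sum_prod2.
Qed.

(** Both bracketings denote the number [8 a + 4 b + 2 c + d], so the readouts, grouped in pairs, and
    the state, grouped around the detectors, can be multiplied. *)
Lemma mxtens_index_assoc4 (a b c d : 'I_2) :
  mxtens_index (mxtens_index (a, b), mxtens_index (c, d)) =
  mxtens_index (mxtens_index (a, mxtens_index (b, c)), d) :> 'I_16.
Proof. by apply/val_inj => /=; rewrite !mulnDl -!mulnA !addnA. Qed.

(** Each Bell projector contributes 1/2 and two Kronecker deltas that identify a question index with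
    a detector index. What remains is a quarter of the trace of [rho] against the tensor product of
    the transposed questions. *)
Lemma answer_prob11 (rho : 'M[C]_(2 * 2)) (q r : 'I_4) :
  answer_prob rho q r true true =
  4^-1 * \sum_(a < 2) \sum_(d < 2) \sum_(a' < 2) \sum_(d' < 2)
    question R q a' a * rho (mxtens_index (a', d')) (mxtens_index (a, d)) *
    question R r d' d.
Proof.
pose Y : 'M[C]_(2 * (2 * 2) * 2) := question R q *t rho *t question R r.
have YE (a b c d a' b' c' d' : 'I_2) :
    (Y : 'M[C]_(2 * 2 * (2 * 2)))
      (mxtens_index (mxtens_index (a, b), mxtens_index (c, d)))
      (mxtens_index (mxtens_index (a', b'), mxtens_index (c', d'))) =
    question R q a a' * rho (mxtens_index (b, c)) (mxtens_index (b', c')) *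
    question R r d d'.
  rewrite (mxtens_index_assoc4 a) (mxtens_index_assoc4 a').
  have YE1 i j k l : Y (mxtens_index (i, j)) (mxtens_index (k, l)) =
    (question R q *t rho) i k * question R r j l by exact: tensmxE.
  by rewrite YE1 tensmxE.
rewrite /answer_prob /mxtrace sum_prod4 big_distrr/=; apply: eq_bigr => a _.
transitivity (\sum_(b < 2) (a == b)%:R * \sum_(c < 2) \sum_(d < 2) (c == d)%:R *
  (4^-1 * \sum_(a' < 2) \sum_(d' < 2)
     question R q a' a * rho (mxtens_index (a', d')) (mxtens_index (b, c)) *
     question R r d' d)).
  apply: eq_bigr => b _; rewrite big_distrr/=; apply: eq_bigr => c _.
  rewrite big_distrr/=; apply: eq_bigr => d _.
  rewrite mxE sum_prod4.
  transitivity (\sum_(a' < 2) \sum_(b' < 2) (a' == b')%:R *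
    \sum_(c' < 2) \sum_(d' < 2) (c' == d')%:R *
      ((a == b)%:R * (c == d)%:R * 4^-1 *
       (question R q a' a * rho (mxtens_index (b', c')) (mxtens_index (b, c)) *
        question R r d' d))).
    apply: eq_bigr => a' _; apply: eq_bigr => b' _.
    rewrite big_distrr/=; apply: eq_bigr => c' _.
    rewrite big_distrr/=; apply: eq_bigr => d' _.
    rewrite (_ : (readout R true *t readout R true) _ _ =
      2^-1 * ((a == b)%:R * (a' == b')%:R) * (2^-1 * ((c == d)%:R * (c' == d')%:R))).
      have -> : (4^-1 : C) = 2^-1 * 2^-1 by rewrite -invfM -natrM.
      by rewrite YE; ring.
    by rewrite -!Phi_plusE tensmxE.
  rewrite mulrA !big_distrr/=; apply: eq_bigr => a' _.
  rewrite sum_delta !big_distrr/=; apply: eq_bigr => c' _.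
  by rewrite sum_delta !mulrA.
rewrite sum_delta big_distrr/=; apply: eq_bigr => c _.
by rewrite sum_delta.
Qed.

Lemma mean_rewardE (Gamma : R) (rho : 'M[C]_(2 * 2)) :
  mean_reward Gamma rho =
  \sum_(q < 4) \sum_(r < 4)
    16^-1 * answer_prob rho q r true true * (reward_matrix Gamma q r)%:C.
Proof.
apply: eq_bigr => q _; apply: eq_bigr => r _.
rewrite !big_bool/= /reward/= !mulr0 !addr0 -invfM -natrM.
by rewrite mulrA.
Qed.

Let k : R := (Num.sqrt 3)^-1.

Let kk : k * k = 3^-1.
Proof. by rewrite /k -invfM -expr2 sqr_sqrtr. Qed.

Definition rewards : seq (seq R) :=
  [:: [:: 8; 8; - 40; 8]; [:: 8; 8; 8; - 40]; [:: - 40; 8; 8; 8]; [:: 8; - 40; 8; 8]].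

Definition bloch_entry (q : nat) (i : nat) : R :=
  (Num.sqrt 3)^-1 * (nth [::] [:: [:: 1; 1; 1]; [:: 1; - 1; - 1];
    [:: - 1; 1; - 1]; [:: - 1; - 1; 1]] q)`_i.

(** Indexed by [nat] so that the entries reduce by computation once the sums over the questions are
    expanded. *)
Definition question_entry (q : nat) (a b : nat) : C :=
  match a, b with
  | 0, 0 => ((1 + bloch_entry q 2) / 2) +i* 0
  | 0, _ => (bloch_entry q 0 / 2) -i* (bloch_entry q 1 / 2)
  | _, 0 => (bloch_entry q 0 / 2) +i* (bloch_entry q 1 / 2)
  | _, _ => ((1 - bloch_entry q 2) / 2) +i* 0
  end.

Lemma blochE (q : 'I_4) (i : 'I_3) : bloch R q i = bloch_entry q i.
Proof. by rewrite !mxE. Qed.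

Lemma questionE (q : 'I_4) (a b : 'I_2) : question R q a b = question_entry q a b.
Proof.
rewrite /question mxE mxE summxE.
under eq_bigr do rewrite mxE blochE.
rewrite !big_ord_recl big_ord0 !mxE.
have -> : (lift ord0 ord0 : 'I_3) = 1%N :> nat by [].
have -> : (lift ord0 (lift ord0 ord0) : 'I_3) = 2%N :> nat by [].
have -> : (ord0 : 'I_3) = 0%N :> nat by [].
rewrite (_ : 2^-1 = (2^-1)%:C); last by rewrite fmorphV/= rmorph_nat.
rewrite /question_entry -!val_eqE.
move: (bloch_entry q 0) (bloch_entry q 1) (bloch_entry q 2) => u v w.
by case: a => -[|[|//]] ia; case: b => -[|[|//]] ib; rewrite /= ?mulr1n ?mulr0n;
  apply/eqP; rewrite eq_complex/=; apply/andP; split; apply/eqP; ring.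
Qed.

(** The sum of the [tau_q] is 2 I, so a uniform reward 8 gives 32 I. The exceptional pairs add -48
    times the sum of [tau_q] (x) [tau_{q'}], where [q'] is the rotated question. The squared Bloch
    components sum to 4/3 and the mixed products to 0, so that sum is I + (- XX + YY - ZZ) / 3 =
    (4/3) (I - Phi^+), and the total is -32 I + 64 Phi^+ = -64 W_0. *)
Lemma sum_rewards (a b c d : 'I_2) :
  \sum_(q < 4) \sum_(r < 4) ((nth [::] rewards q)`_r)%:C *
    (question R q a b * question R r c d) =
  32 * ((a == c)%:R * (b == d)%:R - (a == b)%:R * (c == d)%:R) :> C.
Proof.
under eq_bigr do under eq_bigr do rewrite !questionE.
rewrite !big_ord_recl !big_ord0 /rewards /question_entry /bloch_entry -/k.
rewrite (_ : 32 = (32 : R)%:C); last by rewrite rmorph_nat.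
rewrite -!val_eqE/= !mulr1 !mulrN1.
(* Only [u * u = 1/3] is known about the normalization; every entry is polynomial of degree at most
   two in [u], so linear arithmetic over its monomials closes the sixteen cases. *)
move: (k) kk => u uu.
case: a => -[|[|//]] ia; case: b => -[|[|//]] ib;
  case: c => -[|[|//]] ic; case: d => -[|[|//]] jd; rewrite /= ?mulr1n ?mulr0n.
all: by apply/eqP; rewrite eq_complex/=; apply/andP; split; apply/eqP; lra.
Qed.

Lemma exchange_big_quad (V : nmodType) n (F : 'I_n -> 'I_2 -> 'I_2 -> 'I_2 -> 'I_2 -> V) :
  \sum_r \sum_a \sum_b \sum_c \sum_d F r a b c d =
  \sum_a \sum_b \sum_c \sum_d \sum_r F r a b c d.
Proof.
rewrite exchange_big; apply: eq_bigr => a _; rewrite exchange_big.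
apply: eq_bigr => b _; rewrite exchange_big.
by apply: eq_bigr => c _; rewrite exchange_big.
Qed.

End Game.

(** * The mean reward as a witness value and its expansion *)

Section MeanReward.
Context {R : realType}.
Local Notation C := R[i].

Lemma W0E (a b a' b' : 'I_2) :
  W0 R (mxtens_index (a, b)) (mxtens_index (a', b')) =
  2^-1 * ((a == a')%:R * (b == b')%:R - (a == b)%:R * (a' == b')%:R).
Proof.
have -> : W0 R (mxtens_index (a, b)) (mxtens_index (a', b')) =
    (2^-1)%:M (mxtens_index (a, b)) (mxtens_index (a', b')) -
    Phi_plus R (mxtens_index (a, b)) (mxtens_index (a', b')) by rewrite !mxE.
rewrite Phi_plusE mxE (can_eq (@mxtens_indexK 2 2)) xpair_eqE mulrBr -!natrM !mulnb.
by rewrite !mulr_natr.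
Qed.

Lemma mxtrace_mul_prod2 (A B : 'M[C]_(2 * 2)) :
  \tr (A *m B) = \sum_(a < 2) \sum_(b < 2) \sum_(a' < 2) \sum_(b' < 2)
    A (mxtens_index (a, b)) (mxtens_index (a', b')) *
    B (mxtens_index (a', b')) (mxtens_index (a, b)).
Proof.
rewrite /mxtrace sum_prod2; apply: eq_bigr => a _; apply: eq_bigr => b _.
by rewrite mxE sum_prod2.
Qed.

Lemma mean_reward_W0 (Gamma : R) (rho : 'M[C]_(2 * 2)) :
  mean_reward Gamma rho = - Gamma%:C * \tr (W0 R *m rho).
Proof.
rewrite mean_rewardE mxtrace_mul_prod2.
transitivity (\sum_(q < 4) \sum_(r < 4)
  \sum_(a < 2) \sum_(d < 2) \sum_(a' < 2) \sum_(d' < 2)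
  (64^-1 * Gamma%:C * rho (mxtens_index (a', d')) (mxtens_index (a, d)) *
   (((nth [::] rewards q)`_r)%:C * (question R q a' a * question R r d' d)))).
  apply: eq_bigr => q _; apply: eq_bigr => r _.
  rewrite answer_prob11 (_ : reward_matrix Gamma q r = Gamma * (nth [::] rewards q)`_r).
    have reorg (x : C) (w : R) :
        16^-1 * (4^-1 * x) * (Gamma * w)%:C = 64^-1 * Gamma%:C * w%:C * x.
      by rewrite rmorphM/=; field.
    rewrite reorg !big_distrr/=.
    apply: eq_bigr => a _; rewrite !big_distrr/=; apply: eq_bigr => d _.
    rewrite !big_distrr/=; apply: eq_bigr => a' _.
    rewrite !big_distrr/=; apply: eq_bigr => d' _.
    by ring.
  by rewrite !mxE.
under eq_bigr do rewrite exchange_big_quad.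
rewrite exchange_big_quad big_distrr/=; apply: eq_bigr => a _.
rewrite big_distrr/=; apply: eq_bigr => d _.
rewrite big_distrr/=; apply: eq_bigr => a' _.
rewrite big_distrr/=; apply: eq_bigr => d' _.
under eq_bigr do rewrite -big_distrr/=.
(* The transpositions disappear because W_0 is symmetric; the factor 1/64 is 1/16 for the draw of
   the questions times 1/4 for the readouts. *)
rewrite -big_distrr/= sum_rewards W0E (eq_sym a a') (eq_sym d d').
have n64 : (64 : C) != 0 by rewrite pnatr_eq0.
by field.
Qed.

Definition phase (theta : R) (a : 'I_2) : C := if a == 0 then 1 else expi (- theta).

Lemma calibratedE (theta : R) (rho : 'M[C]_(2 * 2)) (a b a' b' : 'I_2) :
  calibrated theta rho (mxtens_index (a, b)) (mxtens_index (a', b')) =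
  phase theta a * rho (mxtens_index (a, b)) (mxtens_index (a', b')) *
  Num.conj (phase theta a').
Proof.
pose U : 'M[C]_2 := mx_of_rows 2 2 [:: [:: 1; 0]; [:: 0; expi (- theta)]].
have UE (c d : 'I_2) : U c d = (c == d)%:R * phase theta c.
  rewrite mxE /phase -!val_eqE.
  by case: c => -[|[|//]] ic; case: d => -[|[|//]] jd; rewrite /= ?mul1r ?mul0r.
rewrite /calibrated -/U mxE sum_prod2.
transitivity (\sum_(c < 2) (a' == c)%:R * \sum_(d < 2) (b' == d)%:R *
  (phase theta a * rho (mxtens_index (a, b)) (mxtens_index (c, d)) *
   Num.conj (phase theta c))).
  apply: eq_bigr => c _; rewrite big_distrr/=; apply: eq_bigr => d _.
  have UtE : (U ^t*)%sesqui c a' = Num.conj (U a' c) by rewrite !mxE.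
  rewrite tensmxE UtE UE rmorphM rmorph_nat [1%:M _ _]mxE (eq_sym d b').
  rewrite mxE sum_prod2.
  rewrite (_ : \sum_(a0 < 2) _ = \sum_(a0 < 2) (a == a0)%:R * \sum_(b0 < 2) (b == b0)%:R *
    (phase theta a * rho (mxtens_index (a0, b0)) (mxtens_index (c, d)))).
    rewrite sum_delta sum_delta.
    have [->|_] := eqVneq a' c; last by rewrite !mul0r mulr0.
    by ring.
  apply: eq_bigr => a0 _; rewrite big_distrr/=; apply: eq_bigr => b0 _.
  by rewrite tensmxE UE mxE; ring.
by rewrite sum_delta sum_delta.
Qed.

Lemma conj_expi (x : R) : Num.conj (expi x) = expi (- x).
Proof. by rewrite /expi cosN sinN. Qed.

Lemma expi_mulN (x : R) : expi x * expi (- x) = 1.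
Proof. by rewrite mulrC expiN_mul. Qed.

Lemma normr_expi (x : R) : `|expi x| = 1.
Proof. by rewrite normc_def/= cos2Dsin2 sqrtr1. Qed.

Definition igg : 'I_(2 * 2) := mxtens_index ((0 : 'I_2), (0 : 'I_2)).
Definition ige : 'I_(2 * 2) := mxtens_index ((0 : 'I_2), (1 : 'I_2)).
Definition ieg : 'I_(2 * 2) := mxtens_index ((1 : 'I_2), (0 : 'I_2)).
Definition iee : 'I_(2 * 2) := mxtens_index ((1 : 'I_2), (1 : 'I_2)).

(** The diagonal entries of W_0 at gg and ee are [1/2 - 1/2 = 0], so the entry of [rho] of order
    zero never appears. Calibration rotates the two coherences by opposite phases and leaves the
    populations unchanged. *)
Lemma W0_calibrated (theta : R) (rho : 'M[C]_(2 * 2)) :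
  - \tr (W0 R *m calibrated theta rho) =
  2^-1 * (expi theta * rho igg iee + expi (- theta) * rho iee igg -
          rho ige ige - rho ieg ieg).
Proof.
rewrite mxtrace_mul_prod2.
under eq_bigr do under eq_bigr do under eq_bigr do under eq_bigr do
  rewrite W0E calibratedE.
have ord01 : lift ord0 ord0 = 1 :> 'I_2 by apply/val_inj.
rewrite !big_ord_recl !big_ord0 !ord01 /phase -/igg -/ige -/ieg -/iee.
rewrite -!val_eqE/= conj_expi opprK rmorph1.
have := expi_mulN theta; move: (expi theta) (expi (- theta)) => u v uv.
transitivity (2^-1 * (u * rho igg iee + v * rho iee igg - rho ige ige -
  (u * v) * rho ieg ieg)); last by rewrite uv mul1r.
by ring.
Qed.

(** The polar form expresses [theta = arg M] and holds for every [theta] when [M = 0]; the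
    calibration then makes both coherences equal to the modulus. *)
Lemma normc_polar (M : C) (theta : R) : M = `|M| * expi theta ->
  expi (- theta) * M = `|M| /\ expi theta * Num.conj M = `|M|.
Proof.
move=> ME; split; first by rewrite {1}ME mulrCA expiN_mul mulr1.
rewrite {1}ME rmorphM/= conj_expi mulrCA expi_mulN mulr1.
by apply/conj_Creal; exact: normr_real.
Qed.

(** The reward is linear in the state, so the remainder is exactly the same combination of four
    entrywise errors; the second-order entries contribute [Gamma / 2 * lam^2 * (2 h - 2 P)]. *)
Lemma mean_reward_remainder (Gamma P h lam theta : R) (M Lc : C)
    (rho : 'M[C]_(2 * 2)) :
  M = `|M| * expi theta -> `|M| = h%:C ->
  let e i j := rho i j - rho_pert P M Lc lam i j in
  mean_reward Gamma (calibrated theta rho) - (Gamma * lam ^+ 2 * (h - P))%:C =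
  (Gamma / 2)%:C *
    (expi theta * e igg iee + expi (- theta) * e iee igg - e ige ige - e ieg ieg).
Proof.
move=> ME Mh e; have [vM uM] := normc_polar ME.
rewrite mean_reward_W0 mulNr -mulrN W0_calibrated /e.
have -> : rho_pert P M Lc lam igg iee = (lam ^+ 2)%:C * Num.conj M by rewrite mxE.
have -> : rho_pert P M Lc lam iee igg = (lam ^+ 2)%:C * M by rewrite mxE.
have -> : rho_pert P M Lc lam ige ige = (lam ^+ 2)%:C * P%:C by rewrite mxE.
have -> : rho_pert P M Lc lam ieg ieg = (lam ^+ 2)%:C * P%:C by rewrite mxE.
rewrite !rmorphM rmorphB/= fmorphV/= rmorph_nat -Mh.
transitivity (Gamma%:C / 2 * (expi theta * rho igg iee + expi (- theta) * rho iee igg -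
  rho ige ige - rho ieg ieg) - Gamma%:C / 2 * (lam%:C * lam%:C) *
  (expi theta * Num.conj M + expi (- theta) * M - P%:C *+ 2)).
  by rewrite uM vM; field.
by field.
Qed.

Lemma eqO_quartic_mean_reward (Gamma P h theta : R) (M Lc : C)
    (rho : R -> 'M[C]_(2 * 2)) :
  0 < Gamma -> M = `|M| * expi theta -> `|M| = h%:C ->
  (forall i j : 'I_4,
    (fun lam : R => rho lam i j - rho_pert P M Lc lam i j : C^o)
    =O_ ((0 : R)^') (fun lam : R => (lam ^+ 4)%:C : C^o)) ->
  (fun lam : R => mean_reward Gamma (calibrated theta (rho lam)) -
     (Gamma * lam ^+ 2 * (h - P))%:C : C^o)
  =O_ ((0 : R)^') (fun lam : R => (lam ^+ 4)%:C : C^o).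
Proof.
move=> G0 ME Mh rhoO.
have [k1 k10 h1] := (eqO_exP _ _ _).1 (rhoO igg iee).
have [k2 k20 h2] := (eqO_exP _ _ _).1 (rhoO iee igg).
have [k3 k30 h3] := (eqO_exP _ _ _).1 (rhoO ige ige).
have [k4 k40 h4] := (eqO_exP _ _ _).1 (rhoO ieg ieg).
have G20 : 0 < (Gamma / 2)%:C :> C by rewrite ltcR divr_gt0.
apply/eqO_exP; exists ((Gamma / 2)%:C * (k1 + k2 + k3 + k4)).
  by rewrite mulr_gt0// !addr_gt0.
near=> lam; rewrite (mean_reward_remainder Gamma P lam Lc (rho lam) ME Mh).
rewrite normrM (gtr0_norm G20) -mulrA ler_wpM2l ?(ltW G20)//.
have tri (u v w z : C) : `|u + v - w - z| <= `|u| + `|v| + `|w| + `|z|.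
  rewrite (le_trans (ler_normB _ _))// lerD2r (le_trans (ler_normB _ _))//.
  by rewrite lerD2r ler_normD.
(* The calibration phases have modulus one, so the four constants simply add up. *)
rewrite !mulrDl (le_trans (tri _ _ _ _))// !normrM !normr_expi !mul1r.
apply: lerD; [apply: lerD; [apply: lerD|]|].
- by near: lam.
- by near: lam.
- by near: lam.
- by near: lam.
Unshelve. all: by end_near. Qed.

End MeanReward.

Unset Implicit Arguments.

Theorem mainTheorem3 (R : realType) (T L Omega Gamma s : R) (chi : R -> R)
    (T_gt0 : 0 < T) (L_gt0 : 0 < L) (Omega_gt0 : 0 < Omega) (Gamma_gt0 : 0 < Gamma)
    (chi_even : forall t : R, chi (- t) = chi t)
    (chi_derivable : forall t : R, derivable chi t 1)
    (chi_C1 : continuous (derive1 chi))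
    (chi_supp : forall t : R, T < `|t| -> chi t = 0)
    (Lc : R[i]) (theta : R) (rho : R -> 'M[R[i]]_(2 * 2))
    (rho_density : \forall lam \near (0 : R)^', density_matrix (rho lam))
    (rho_expansion : forall i j : 'I_4,
       (fun lam : R => rho lam i j -
          rho_pert (P_exc Omega chi) (M_amp L Omega s chi) Lc lam i j : R[i]^o)
       =O_ ((0 : R)^') (fun lam : R => (lam ^+ 4)%:C : R[i]^o))
    (theta_arg : M_amp L Omega s chi = `|M_amp L Omega s chi| * expi theta) :
  let P := P_exc Omega chi in
  let M := M_amp L Omega s chi in
  let C := C_overlap Omega chi in
  let pv_integrand := fun zeta : R => C zeta / (L ^+ 2 - (zeta - s) ^+ 2) in
  let poles := [:: s - L; s + L] in
  let Z := - expi (- (Omega * s)) * M in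
  let H := complex.Re Z in
  let Q := complex.Im Z in
  let rho' := fun lam : R => calibrated theta (rho lam) in
  let G := fun lam : R => mean_reward Gamma (rho' lam) in
  (P_reg Omega chi eps @[eps --> (0 : R)^'+] --> (P%:C : R[i]^o) /\
   cvg (M_reg L Omega s chi eps @[eps --> (0 : R)^'+]) /\
   cvg (pv_reg (- (2 * T)) (2 * T) poles pv_integrand delta
          @[delta --> (0 : R)^'+])) /\
  H = 1 / (4 * pi ^+ 2) * PV (- (2 * T)) (2 * T) poles pv_integrand /\
  Q = - ((C (s - L) + C (s + L)) / (8 * pi * L)) /\
  (forall lam : R, G lam = - Gamma%:C * \tr (W0 R *m rho' lam)) /\
  (fun lam : R => G lam -
     (Gamma * lam ^+ 2 * (Num.sqrt (H ^+ 2 + Q ^+ 2) - P))%:C : R[i]^o)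
  =O_ ((0 : R)^') (fun lam : R => (lam ^+ 4)%:C : R[i]^o).
Proof.
move=> P M C pv_integrand poles Z H Q rho' G.
have [K K0 chi_lip] := C1_supported_lipschitz T_gt0 chi_derivable chi_C1 chi_supp.
have chiB := lipschitz_supported_bounded T_gt0 K0 chi_lip chi_supp.
have cP := P_reg_lim (Omega := Omega) T_gt0 K0 chi_lip chiB chi_supp.
have cM := M_reg_lim (Omega := Omega) (s := s) T_gt0 K0 chi_lip chiB chi_supp chi_even L_gt0.
have fE (x : R) : pv_integrand x = C x / (L ^+ 2 - (x - s) ^+ 2) by [].
have cPV := cvg_pv_overlap T_gt0 K0 chi_lip chiB chi_supp L_gt0 fE.
have HE := hadamard_PV T_gt0 K0 chi_lip chiB chi_supp L_gt0 fE.
have ZE := calibrated_amp T_gt0 K0 chi_lip chiB chi_supp chi_even Omega s L_gt0.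
(* [Z] differs from [M] by a factor of modulus one, so the two quadratures determine the modulus
   that calibration extracts. *)
have nM : `|M| = (Num.sqrt (H ^+ 2 + Q ^+ 2))%:C.
  by rewrite -normc_def normrM normrN normr_expi mul1r.
split; first split; first exact: cP.
  split; apply/cvg_ex; first by eexists; exact: cM.
  by eexists; exact: cPV.
split; first by rewrite /H /Z /M ZE; exact: HE.
split; first by rewrite /Q /Z /M ZE.
split; first by move=> lam; exact: mean_reward_W0.
exact: (eqO_quartic_mean_reward Gamma_gt0 theta_arg nM rho_expansion).
Qed.
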